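(* Let $G$ be an infinite, connected, bipartite graph with maximum degree $d$ and Cheeger constant $h$, and let $M\ge 1$ be an integer. Assume $h\ge 4M\log\big(3d^4(4M+1)\big)$. Let $a\le b$ be integers with $b-a\le 2M$. (a) For every exhaustion $(G_n)$ of $G$, the measures $\nu^{a,b}_{G_n,M}$ converge as $n\to\infty$ to a Gibbs measure $\nu^{a,b}_{G,M}$. (b) The measures $\nu^{a,b}_{G,M}$ are distinct for different pairs $(a,b)$.
   Context: The Cheeger constant is $h(G)=\inf\{|\partial S|/|S| : S\subset V,\ 0<|S|<\infty\}$, where $\partial S$ is the set of vertices not in $S$ having at least one neighbour in $S$. The two partite classes of $G$ are colored white and black. An $M$-Lipschitz function on a set of vertices is a function $f$ to $\mathbb{Z}$ with $|f(u)-f(v)|\le M$ for adjacent $u,v$ in that set. For a finite vertex set $U$ and integers $a\le b$, $\nu^{a,b}_{U,M}$ is the uniform probability measure on the set of $M$-Lipschitz functions on $U\cup\partial U$ whose value at each white vertex of $\partial U$ lies in $\{a,\dots,b\}$ and whose value at each black vertex of $\partial U$ lies in $\{b-M,\dots,a+M\}$. An exhaustion of $G$ is a sequence of finite vertex sets $G_1\subset G_2\subset\cdots$ with $\bigcup_n G_n=V(G)$. Convergence is local weak convergence: for each finite set of vertices, the joint law of the values there converges. *)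

(* Defs.v *)
From HB Require Import structures.
From mathcomp Require Import all_boot all_order all_algebra.
From mathcomp Require Import finmap.
From mathcomp Require Import all_classical all_reals all_analysis.

Set Implicit Arguments.
Unset Strict Implicit.
Unset Printing Implicit Defensive.
Import Order.TTheory GRing.Theory Num.Theory.
Local Open Scope classical_set_scope.
Local Open Scope ring_scope.

(* int is pointed by 0 (needed for the configuration space V -> int) *)
HB.instance Definition _ := isPointed.Build int 0%R.

Section Graph.
Variable V : eqType.
(* A locally finite graph is given by its neighbour lists. *)
Variable nb : V -> seq V.

Definition adj (u v : V) : bool := v \in nb u.

Definition simple_graph : Prop :=
  forall u, [/\ uniq (nb u), u \notin nb u & forall v, (v \in nb u) = (u \in nb v)].

Definition infinite_graph : Prop := forall s : seq V, exists v, v \notin s.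

Definition connected_graph : Prop :=
  forall u v, exists p : seq V, path adj u p /\ last u p = v.

Definition max_degree (d : nat) : Prop :=
  (forall v, (size (nb v) <= d)%N) /\ exists v, size (nb v) = d.

(* bipartition: col v = true means v is white, false means black *)
Definition proper_2coloring (col : V -> bool) : Prop :=
  forall u v, adj u v -> col u != col v.

Definition vboundary (S : seq V) : seq V :=
  undup [seq w <- flatten (map nb S) | w \notin S].

Definition cheeger (R : realType) : R :=
  inf [set x : R | exists S : seq V, S != [::] /\
        x = (size (vboundary S))%:R / (size (undup S))%:R].

Definition lipschitz_on (M : nat) (D : seq V) (f : V -> int) : Prop :=
  forall u v, u \in D -> v \in D -> adj u v -> `|f u - f v| <= M%:Z.

Definition lipschitz_touch (M : nat) (U : seq V) (f : V -> int) : Prop :=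
  forall u v, u \in U -> adj u v -> `|f u - f v| <= M%:Z.

(* admissible configurations for nu^{a,b}_{U,M} (only values on U u dU matter) *)
Definition admissible (M : nat) (col : V -> bool) (a b : int) (U : seq V)
  (f : V -> int) : Prop :=
  lipschitz_on M (U ++ vboundary U) f /\
  forall v, v \in vboundary U ->
    (col v -> a <= f v <= b) /\ (~~ col v -> b - M%:Z <= f v <= a + M%:Z).

Definition codes (D : seq V) (P : set (V -> int)) : set (seq int) :=
  [set [seq f v | v <- D] | f in P].

(* nu^{a,b}_{U,M}(E): uniform measure on admissible functions on U u dU,
   evaluated at an event E depending only on the values on U u dU *)
Definition nu_fin (R : realType) (M : nat) (col : V -> bool) (a b : int)
  (U : seq V) (E : set (V -> int)) : R :=
  (#|` fset_set (codes (U ++ vboundary U) (admissible M col a b U `&` E))|%:R)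
  / (#|` fset_set (codes (U ++ vboundary U) (admissible M col a b U))|%:R).

Definition cyl (F : seq V) (g : V -> int) : set (V -> int) :=
  [set f | forall v, v \in F -> f v = g v].

Definition cylinders : set (set (V -> int)) :=
  [set A | exists F g, A = cyl F g].

Local Notation Omega := (g_sigma_algebraType cylinders).

(* specification gamma_U(g|_U | g|_{dU}): uniform over the M-Lipschitz
   extensions on U of the boundary values (edges touching U constrained) *)
Definition spec (R : realType) (M : nat) (U : seq V) (g : V -> int) : R :=
  (asbool (lipschitz_touch M U g))%:R /
  (#|` fset_set (codes U [set h | lipschitz_touch M U
                          (fun v => if v \in U then h v else g v)])|%:R).

(* DLR equations, on cylinder events over W containing U u dU *)
Definition gibbs (R : realType) (M : nat) (mu : probability Omega R) : Prop :=
  forall (U W : seq V) (g : V -> int),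
    {subset U ++ vboundary U <= W} ->
    mu (cyl W g) = (mu (cyl [seq w <- W | w \notin U] g) * (spec R M U g)%:E)%E.

Definition exhaustion (Gs : nat -> seq V) : Prop :=
  (forall n, {subset Gs n <= Gs n.+1}) /\ (forall v, exists n, v \in Gs n).

End Graph.

Notation Omega V := (g_sigma_algebraType (@cylinders V)).

(* Main.v *)
Require Import Defs.
From HB Require Import structures.
From mathcomp Require Import all_boot all_order all_algebra.
From mathcomp Require Import finmap.
From mathcomp Require Import all_classical all_reals all_analysis.
From mathcomp Require Import zify ring lra.
Import Order.TTheory GRing.Theory Num.Theory.
Local Open Scope classical_set_scope.
Local Open Scope ring_scope.
Set Implicit Arguments.
Unset Strict Implicit.
Unset Printing Implicit Defensive.

(** Call a value at [v] good if it lies in the phase [lo v, hi v]: [a, b] at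
    white vertices, [b - M, a + M] at black ones.  Good values at neighbours are
    always compatible, while next to a bad vertex at least one good value is
    lost.  Given a set S of bad vertices whose vertices at distance 1 and 2 are
    good, resampling S and its boundary gains a factor (1 + 1/2M) for each of
    the at least h|S| boundary vertices and costs at most 4M + 1 for each vertex
    of S; hence such sets have exponentially small probability.

    Take independent samples f, f' in two finite volumes and let K be the cluster
    of vertices bad for f or f', connected through steps of length at most 2,
    grown from a finite set F.  If K and its neighbours lie in both volumes,
    exchanging f and f' there is a measure preserving involution, so the laws on F
    differ by at most the probability that K is large.  Clusters of k vertices
    are traced by walks of 2(k-1) such steps, of which there are at most
    d^(4(k-1)), and the Peierls bound for pairs beats this number.  Thus the
    finite volume laws form a Cauchy net, uniformly over the events that depend
    on a given finite set, which also yields tightness.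

    The limiting finite dimensional laws are realised on [0, 1) by nested
    intervals.  The phases are told apart by one vertex: a value inside the
    phase has probability at least (1 - d^-3)/(2M+1), a value outside at most
    d^-4. *)

(** * Counting *)

Section Counting.
Local Open Scope nat_scope.

(** The same count as in [nu_fin] and [spec]. Infinite sets get 0, hence the finiteness hypotheses
    in what follows. *)
Definition ncard (T : choiceType) (A : set T) : nat := #|` fset_set A|.

Lemma ncard0 (T : choiceType) : ncard (set0 : set T) = 0.
Proof. by rewrite /ncard fset_set0 cardfs0. Qed.

Lemma finite_inj (T T' : Type) (f : T -> T') (A : set T) (B : set T') :
  finite_set B -> {in A &, injective f} -> (forall x, A x -> B (f x)) ->
  finite_set A.
Proof.
move=> fB fi fAB; rewrite -(eq_finite_set (inj_card_eq fi)).
by apply: sub_finite_set fB => _ [x Ax <-]; exact: fAB.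
Qed.

Lemma ncard_inj (T T' : choiceType) (f : T -> T') (A : set T) (B : set T') :
  finite_set B -> {in A &, injective f} -> (forall x, A x -> B (f x)) ->
  ncard A <= ncard B.
Proof.
move=> fB fi fAB; have fA := finite_inj fB fi fAB.
rewrite /ncard; apply: (@leq_trans #|` f @` fset_set A|%fset).
  rewrite card_in_imfset// => x y; rewrite !in_fset_set// => xA yA; exact: fi.
rewrite -fset_set_image// fsubset_leq_card// -fset_set_sub//.
  by move=> _ [x Ax <-]; exact: fAB.
exact: finite_image.
Qed.

(** No finiteness is assumed: an injective image is infinite together with the set, and then both
    count 0. *)
Lemma ncard_bij (T T' : choiceType) (f : T -> T') (A : set T) (B : set T') :
  {in A &, injective f} -> f @` A = B -> ncard A = ncard B.
Proof.
move=> fi fAB; have [fB|nfB] := pselect (finite_set B); last first.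
  rewrite /ncard /fset_set; case: pselect => fA; last by case: pselect.
  by exfalso; apply: nfB; rewrite -fAB; exact: finite_image.
have fA : finite_set A by apply: (finite_inj fB fi) => x Ax; rewrite -fAB; exists x.
rewrite /ncard -fAB fset_set_image// card_in_imfset// => x y.
rewrite !in_fset_set// => xA yA; exact: fi.
Qed.

Lemma ncard_sub (T : choiceType) (A B : set T) :
  finite_set B -> A `<=` B -> ncard A <= ncard B.
Proof. by move=> fB AB; apply: (@ncard_inj _ _ id) => // x; exact: AB. Qed.

Lemma ncard_le_size (T : choiceType) (A : set T) (s : seq T) :
  (forall x, A x -> x \in s) -> ncard A <= size s.
Proof.
move=> As; apply: (@leq_trans (ncard [set` s])).
  apply: ncard_sub => //; exact: finite_seq.
rewrite /ncard; apply: (@leq_trans (size (undup s))); last exact: size_undup.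
apply: uniq_leq_size; first exact: fset_uniq.
by move=> x; rewrite in_fset_set; [rewrite mem_setE mem_undup|exact: finite_seq].
Qed.

Lemma ncard_uniq (T : choiceType) (s : seq T) :
  uniq s -> ncard [set` s] = size s.
Proof.
move=> us; rewrite /ncard; apply/perm_size/uniq_perm => // x.
by rewrite in_fset_set; [rewrite mem_setE|exact: finite_seq].
Qed.

Lemma ncardX (T T' : choiceType) (A : set T) (B : set T') :
  finite_set A -> finite_set B -> ncard (A `*` B) = ncard A * ncard B.
Proof.
move=> fA fB.
have -> : A `*` B = [set` allpairs pair (fset_set A) (fset_set B)].
  apply/seteqP; split=> -[x y] /=.
    by move=> [Ax By]; apply/allpairsP; exists (x, y); rewrite !in_fset_set// !inE.
  by move=> /allpairsP[[x' y']] /= []; rewrite !in_fset_set// !inE => Ax By [-> ->].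
rewrite ncard_uniq ?size_allpairs//; apply: allpairs_uniq => //; try exact: fset_uniq.
by move=> [x y] [x' y'].
Qed.

Lemma ncardU (T : choiceType) (A B : set T) :
  finite_set A -> finite_set B -> ncard (A `|` B) <= ncard A + ncard B.
Proof. by move=> fA fB; rewrite /ncard fset_setU// cardfsU leq_subr. Qed.

Lemma ncardID (T : choiceType) (A B : set T) :
  finite_set A -> ncard A = ncard (A `&` B) + ncard (A `\` B).
Proof.
move=> fA; have fAB : finite_set (A `&` B) by exact: finite_setIl.
have -> : A `\` B = A `\` (A `&` B).
  apply/seteqP; split=> x [Ax nB]; split=> //.
    by case.
  by move=> Bx; exact: nB.
rewrite /ncard [in X in _ = _ + X]fset_setD// cardfsD.
have -> : (fset_set A `&` fset_set (A `&` B))%fset = fset_set (A `&` B).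
  by apply/fsetIidPr; rewrite -fset_set_sub//; exact: subIsetl.
by rewrite subnKC// fsubset_leq_card// -fset_set_sub//; exact: subIsetl.
Qed.

Lemma ncard_cover (T : choiceType) (I : eqType) (s : seq I) (A : set T)
    (F : I -> set T) :
  finite_set A -> (forall x, A x -> exists2 i, i \in s & F i x) ->
  ncard A <= \sum_(i <- s) ncard (A `&` F i).
Proof.
elim: s A => [|i s IH] A fA AF.
  rewrite big_nil leqn0 (_ : A = set0) ?ncard0//.
  by rewrite predeqE => x; split=> // /AF[].
rewrite big_cons (@ncardID _ A (F i))// leq_add2l.
have fD : finite_set (A `\` F i) by exact: finite_setD.
apply: leq_trans (IH _ fD _) _; last first.
  apply: leq_sum => j _; apply: ncard_sub; first exact: finite_setIl.
  by move=> x [[]].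
move=> x [/AF[j]]; rewrite inE => /orP[/eqP -> //|js Fj _].
by exists j.
Qed.

Lemma ncard_fiber (T T' : choiceType) (f : T -> T') (A : set T) (B : set T')
    (p : nat) :
  finite_set A -> finite_set B -> (forall x, A x -> B (f x)) ->
  (forall y, ncard (A `&` [set x | f x = y]) <= p) ->
  ncard A <= p * ncard B.
Proof.
move=> fA fB fAB fp.
apply: leq_trans (@ncard_cover _ _ (fset_set B) A (fun y => [set x | f x = y]) fA _) _.
  by move=> x Ax; exists (f x) => //; rewrite in_fset_set// inE; exact: fAB.
apply: (@leq_trans (\sum_(i <- fset_set B) p)); first by apply: leq_sum.
by rewrite big_const_seq count_predT iter_addn_0.
Qed.

(** Recording the value at the head v of [D] apart from the function with v reset to 0 embeds the
    box into an interval times a smaller box. *)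
Lemma finite_box (V : eqType) (D : seq V) (L : nat) :
  finite_set [set f : V -> int | (forall v, v \notin D -> f v = 0) /\
                                 (forall v, `|f v|%N <= L)].
Proof.
pose B := [seq (i%:Z - L%:Z)%R | i <- iota 0 (L + L).+1].
elim: D => [|v D IH].
  apply: (@sub_finite_set _ _ [set fun=> 0%R]); last exact: finite_set1.
  by move=> f [f0 _] /=; apply/funext => x; exact: f0.
apply: (@finite_inj _ _ (fun f : V -> int => (f v, fun w => if w == v then 0%R else f w))
  _ ([set` B] `*` [set f : V -> int | (forall v, v \notin D -> f v = 0%R) /\
                                   (forall v, `|f v| <= L)])).
- apply: finite_setX; first exact: (finite_seq B).
  exact: IH.
- move=> f f' _ _ [fv fw]; apply/funext => w; have [->//|wv] := eqVneq w v.
  by move/(congr1 (@^~ w)): fw; rewrite (negbTE wv).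
- move=> f [f0 fL] /=; split=> /=.
    apply/mapP; exists (`|(f v + L%:Z)%R|)%N.
      by rewrite mem_iota; have := fL v; lia.
    by have := fL v; lia.
  split=> [w wD|w]; case: eqVneq => //= wv.
  by apply: f0; rewrite inE (negbTE wv).
Qed.

Definition upd (V : eqType) (f : V -> int) (w : V) (z : int) : V -> int :=
  fun v => if v == w then z else f v.

(** Double counting along (f, z) -> [upd f w z], from [A] times [Q] to [A']. A point of a fibre is
    determined by the value erased at w, so a fibre is no larger than the list of values that could
    have stood there. *)
Lemma resample (V : eqType) (A A' : set (V -> int)) (w : V) (Q : seq int)
    (p : nat) :
  finite_set A -> finite_set A' -> uniq Q ->
  (forall f, exists2 Y : seq int, size Y <= p & forall y, A (upd f w y) -> y \in Y) ->
  (forall f z, A f -> z \in Q -> A' (upd f w z)) ->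
  size Q * ncard A <= p * ncard A'.
Proof.
move=> fA fA' uQ hY hQ.
rewrite mulnC -(ncard_uniq uQ) -ncardX; [|exact: fA|exact: finite_seq].
apply: (@ncard_fiber _ _ (fun x : (V -> int) * int => upd x.1 w x.2)) => //.
- by apply: finite_setX => //; exact: finite_seq.
- by move=> [f z] [/= Af zQ]; exact: hQ.
move=> f; have [Y sY AY] := hY f; apply: leq_trans sY.
apply: (@leq_trans (ncard [set` Y])); last exact: ncard_le_size.
have upd1 (h : V -> int) z : upd h w z = f -> h = upd f w (h w).
  move=> <-; apply/funext => v; rewrite /upd; case: eqVneq => // ->; done.
apply: (@ncard_inj _ _ (fun x : (V -> int) * int => x.1 w)).
- exact: finite_seq.
- move=> [h z] [h' z']; rewrite !inE => -[_ /= e] [_ /= e'] hh'.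
  have -> : z = z'.
    by move/(congr1 (@^~ w)): e; move/(congr1 (@^~ w)): e'; rewrite /upd eqxx => -> ->.
  congr pair.
  by rewrite (upd1 h _ e) (upd1 h' _ e') /= hh'.
- by move=> [h z] [[/= Ah zQ] e]; apply: AY; rewrite -(upd1 h _ e).
Qed.

End Counting.

(** * The Peierls estimate *)

Section Peierls.
Variables (V : eqType) (nb : V -> seq V) (M : nat) (lo hi : V -> int).
Hypothesis sg : simple_graph nb.
Hypothesis lohi : forall v, lo v <= hi v <= lo v + 2 * M%:Z.
Hypothesis hilo : forall u v, v \in nb u -> hi u = lo v + M%:Z.
Hypothesis exit : forall S : seq V, S != [::] ->
  exists s w, [/\ s \in S, w \notin S & w \in nb s].

Lemma nb_sym u v : (v \in nb u) = (u \in nb v).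
Proof. by have [_ _] := sg u. Qed.

Definition with_boundary (U : seq V) := U ++ vboundary nb U.

(** In the block of a neighbour v the vertex u gives way to v itself, which keeps the length of
    [nb v]; with degrees at most d the list has at most d^2 entries. *)
Definition nb2 (u : V) : seq V := flatten [seq v :: rem u (nb v) | v <- nb u].

Lemma mem_nb2 u v :
  v \in nb2 u <-> v \in nb u \/ (v != u /\ exists2 w, w \in nb u & v \in nb w).
Proof.
split.
  move=> /flatten_mapP[w wu]; rewrite inE => /orP[/eqP->|]; first by left.
  have [uw _ _] := sg w; rewrite mem_rem_uniq// !inE => /andP[vu vw].
  by right; split=> //; exists w.
move=> [vu|[vu [w wu vw]]]; apply/flatten_mapP.
  by exists v => //; rewrite inE eqxx.
exists w => //; have [uw _ _] := sg w.
by rewrite inE mem_rem_uniq// !inE vu vw orbT.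
Qed.

Lemma nb2_sym u v : v \in nb2 u -> u \in nb2 v.
Proof.
move=> /mem_nb2[vu|[vu [w wu vw]]]; apply/mem_nb2; first by left; rewrite nb_sym.
by right; split; [rewrite eq_sym|exists w; rewrite nb_sym].
Qed.

Lemma nb2_nb u w v : w \in nb u -> v \in nb w -> v != u -> v \in nb2 u.
Proof. by move=> wu vw vu; apply/mem_nb2; right; split=> //; exists w. Qed.

Lemma nb_nb2 u v : v \in nb u -> v \in nb2 u.
Proof. by move=> vu; apply/mem_nb2; left. Qed.

Lemma mem_vboundary U w :
  w \in vboundary nb U <-> w \notin U /\ exists2 u, u \in U & w \in nb u.
Proof.
rewrite /vboundary mem_undup mem_filter; split.
  by move=> /andP[-> /flatten_mapP[u uU wu]]; split=> //; exists u.
by move=> [-> [u uU wu]]; apply/flatten_mapP; exists u.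
Qed.

Lemma dom_sub U u : u \in U -> u \in with_boundary U.
Proof. by rewrite mem_cat => ->. Qed.

Lemma dom_bd U u : u \in vboundary nb U -> u \in with_boundary U.
Proof. by rewrite mem_cat => ->; rewrite orbT. Qed.

Lemma dom_nb U u v : u \in U -> v \in nb u -> v \in with_boundary U.
Proof.
move=> uU vu; have [/dom_sub//|vU] := boolP (v \in U).
by apply: dom_bd; apply/mem_vboundary; split=> //; exists u.
Qed.

Definition in_phase (f : V -> int) v := lo v <= f v <= hi v.

(** Fixing the value 0 off the domain selects one representative of each function on the domain, so
    that the set is finite and can be counted. *)
Definition conf (U : seq V) : set (V -> int) := [set f |
  [/\ forall v, v \notin with_boundary U -> f v = 0, Defs.lipschitz_on nb M (with_boundary U) f &
      forall v, v \in vboundary nb U -> in_phase f v]].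

(** Used along both directions of the edge, [hilo] gives x <= hi u = lo v + M <= y + M and the same
    with x and y exchanged. *)
Lemma gd_gd u v x y : v \in nb u -> lo u <= x <= hi u -> lo v <= y <= hi v ->
  `|x - y| <= M%:Z.
Proof.
move=> vu; have h1 := hilo vu; rewrite nb_sym in vu; have h2 := hilo vu; lia.
Qed.

Lemma bounded_on (D : seq V) (g : V -> int) :
  exists L : nat, forall v, v \in D -> (`|g v| <= L)%N.
Proof.
elim: D => [|v D [L IH]]; first by exists 0%N.
exists (maxn `|g v| L) => w; rewrite inE leq_max => /orP[/eqP->|/IH->].
  by rewrite leqnn.
by rewrite orbT.
Qed.

(** A bound off [S] spreads inwards: [exit] finds a vertex of [S] with a neighbour outside, where
    the bound grows by M, and this vertex is then removed from [S]. *)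
Lemma peel_bound (U S : seq V) (n : nat) : (size S <= n)%N -> {subset S <= U} ->
  (exists L : nat, forall f, conf U f -> forall v, v \notin S -> (`|f v| <= L)%N) ->
  exists L : nat, forall f, conf U f -> forall v, (`|f v| <= L)%N.
Proof.
elim: n S => [|n IH] S.
  by rewrite leqn0 size_eq0 => /eqP-> _ [L hL]; exists L => f cf v; exact: hL.
move=> sS SU [L hL].
have [S0|S0] := eqVneq S [::]; first by exists L => f cf v; apply: hL => //; rewrite S0.
have [s [w [sS' wS ws]]] := exit S0.
apply: (IH [seq x <- S | x != s]).
- rewrite -ltnS; apply: leq_trans sS.
  rewrite size_filter -(count_predC (fun x => x != s) S) -[X in (X < _)%N]addn0.
  rewrite ltn_add2l -has_count; apply/hasP; exists s => //=.
  by rewrite eqxx.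
- by move=> x; rewrite mem_filter => /andP[_ /SU].
exists (L + M)%N => f cf v; rewrite mem_filter negb_and negbK.
move=> /orP[/eqP->|vS]; last by have := hL f cf v vS; lia.
have hw := hL f cf w wS; have [_ fl _] := cf.
have := fl s w (dom_sub (SU _ sS')) (dom_nb (SU _ sS') ws) ws; lia.
Qed.

Lemma conf_bound U :
  exists L : nat, forall f, conf U f -> forall v, (`|f v| <= L)%N.
Proof.
apply: (@peel_bound U U (size U)) => //.
have [L1 h1] := bounded_on (vboundary nb U) lo.
have [L2 h2] := bounded_on (vboundary nb U) hi.
exists (L1 + L2)%N => f [f0 _ fb] v vU.
have [vb|vb] := boolP (v \in vboundary nb U).
  by have := fb v vb; have := h1 v vb; have := h2 v vb; rewrite /in_phase; lia.
by rewrite f0// mem_cat negb_or vU.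
Qed.

Lemma finite_conf U : finite_set (conf U).
Proof.
have [L hL] := conf_bound U; apply: sub_finite_set (finite_box (with_boundary U) L).
by move=> f cf; split=> [v vU|v]; [have [->] := cf|exact: hL].
Qed.

(** The lower ends of the phases are good values, hence compatible; this keeps the normalising
    constants positive. *)
Lemma conf_ground U : conf U (fun v => if v \in with_boundary U then lo v else 0).
Proof.
have g v : lo v <= lo v <= hi v by have := lohi v; lia.
split=> [v /negbTE-> //|u v uD vD uv|v vb].
  by rewrite uD vD; exact: gd_gd uv (g u) (g v).
by rewrite /in_phase dom_bd.
Qed.

Lemma ncard_conf_gt0 U : (0 < ncard (conf U))%N.
Proof.
rewrite /ncard cardfs_gt0; apply/fset0Pn.
exists (fun v => if v \in with_boundary U then lo v else 0).
by rewrite in_fset_set ?inE; [exact: conf_ground|exact: finite_conf].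
Qed.

(** For [S] inside [U], this makes [S] a union of components of the bad set under steps of length at
    most 2. *)
Definition clust (U S : seq V) : set (V -> int) := [set f |
  [/\ conf U f, forall s, s \in S -> ~~ in_phase f s &
      forall v s, v \in with_boundary U -> v \notin S -> s \in S -> v \in nb2 s -> in_phase f v]].

(* The vertices of [X] have already been resampled to good values. *)
Definition resampled (U S : seq V) (L : nat) (X : seq V) : set (V -> int) :=
  [set f |
  [/\ forall v, v \notin with_boundary U -> f v = 0, forall v, (`|f v| <= L)%N,
      forall v, v \in vboundary nb U -> in_phase f v & forall v, v \in X -> in_phase f v] /\
  [/\ forall v s, v \in with_boundary U -> v \notin S -> s \in S -> v \in nb2 s -> in_phase f v,
      forall u v, u \in with_boundary U -> v \in with_boundary U -> u \notin X -> v \notin X ->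
        v \in nb u -> `|f u - f v| <= M%:Z,
      forall s, s \in S -> s \notin X -> ~~ in_phase f s &
      forall s w, s \in S -> s \notin X -> w \in vboundary nb S -> w \in nb s ->
        lo w - M%:Z <= f s <= hi w + M%:Z]].

Definition iv (x : int) (n : nat) : seq int := [seq x + i%:Z | i <- iota 0 n].

Lemma mem_iv x n z : (z \in iv x n) = (x <= z < x + n%:Z).
Proof.
apply/mapP/idP => [[i]|h]; first by rewrite mem_iota => hi' ->; lia.
by exists `|z - x|%N; rewrite ?mem_iota; lia.
Qed.

Lemma uniq_iv x n : uniq (iv x n).
Proof. by rewrite map_inj_uniq ?iota_uniq// => i j; lia. Qed.

Lemma size_iv x n : size (iv x n) = n.
Proof. by rewrite size_map size_iota. Qed.

(** * Resampling a bad set and its boundary *)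

Section Cluster.
Variables (U S : seq V) (L : nat).
Hypothesis SU : {subset S <= U}.
Hypothesis Llo : forall v, v \in with_boundary U -> (`|lo v| <= L)%N.
Hypothesis Lhi : forall v, v \in with_boundary U -> (`|hi v| <= L)%N.
Local Notation Phi := (resampled U S L).
Local Notation dS := (vboundary nb S).

Lemma finite_resampled X : finite_set (Phi X).
Proof. by apply: sub_finite_set (finite_box (with_boundary U) L) => f [[]]. Qed.

Lemma resampled_upd X x z f : x \in S ++ dS -> lo x <= z <= hi x -> Phi X f ->
  Phi (x :: X) (upd f x z).
Proof.
move=> xS gz [[f0 fL fb fX] [fg fl fbad fr]].
have xD : x \in with_boundary U.
  move: xS; rewrite mem_cat => /orP[/SU/dom_sub//|/mem_vboundary[_ [u /SU uU]]].
  exact: dom_nb.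
have gdx v : in_phase f v -> in_phase (upd f x z) v.
  by rewrite /in_phase /upd; case: eqVneq => // ->.
split; split.
- move=> v vD; rewrite /upd; case: eqVneq => [vx|_]; last exact: f0.
  by rewrite vx xD in vD.
- move=> v; rewrite /upd; case: eqVneq => [_|_]; last exact: fL.
  by have := Llo xD; have := Lhi xD; lia.
- by move=> v /fb/gdx.
- move=> v; rewrite inE => /orP[/eqP->|/fX/gdx//].
  by rewrite /in_phase /upd eqxx.
- by move=> v s vD vS sS vs; apply: gdx; exact: fg vs.
- move=> u v uD vD; rewrite !inE !negb_or => /andP[ux uX] /andP[vx vX] uv.
  by rewrite /upd (negbTE ux) (negbTE vx); exact: fl.
- move=> s sS; rewrite inE negb_or => /andP[sx sX].
  by have := fbad s sS sX; rewrite /in_phase /upd (negbTE sx).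
- move=> s w sS; rewrite inE negb_or => /andP[sx sX] ws wdS.
  by rewrite /upd (negbTE sx); exact: fr.
Qed.

(** The vertex w has a bad neighbour s in [S] that still has its old value. If this value is below
    the phase, it is incompatible with hi w = lo s + M; if above, with lo w = hi s - M. So the old
    value at w was one of g = hi w - lo w values, while the new one ranges over g + 1. *)
Lemma boundary_step (X : seq V) (w : V) : w \in dS -> w \notin X ->
  {subset X <= dS} ->
  ((2 * M).+1 * ncard (Phi X) <= 2 * M * ncard (Phi (w :: X)))%N.
Proof.
move=> wdS wX XdS.
have [wS [s sS sw]] := (mem_vboundary _ _).1 wdS.
have ws := sw; rewrite nb_sym in ws.
have sX : s \notin X.
  by apply/negP => /XdS /mem_vboundary[]; rewrite sS.
have wD : w \in with_boundary U by exact: dom_nb (SU sS) sw.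
have sw' : s != w by apply: contraTneq sS => ->.
pose g := `|(hi w - lo w)|%N.
have gE : g%:Z = hi w - lo w by rewrite /g; have := lohi w; lia.
have gM : (g <= 2 * M)%N by have := lohi w; lia.
have : (g.+1 * ncard (Phi X) <= g * ncard (Phi (w :: X)))%N.
  rewrite -[g.+1](size_iv (lo w)).
  apply: (@resample _ _ _ w); rewrite ?uniq_iv//; try exact: finite_resampled.
    move=> f; exists (if f s <= lo s - 1 then iv (lo w) g else iv (lo w + 1) g).
      by case: ifP; rewrite size_iv.
    move=> y [[_ _ _ _] [fg fl fbad _]].
    have := fg w s wD wS sS (nb_nb2 sw).
    have := fbad s sS sX; have := fl s w (dom_sub (SU sS)) wD sX wX sw.
    rewrite /in_phase /upd eqxx (negbTE sw').
    have := hilo sw; have := hilo ws.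
    by case: ifP; rewrite mem_iv; lia.
  move=> f z Pf; rewrite mem_iv => hz; apply: resampled_upd => //.
    by rewrite mem_cat wdS orbT.
  lia.
(* The ratio (g + 1) / g is smallest for g = 2M; empty sets are split off before the nonlinear
   arithmetic. *)
case: (ncard (Phi X)) => [|a]; first by rewrite !muln0.
case: (ncard (Phi (w :: X))) => [|b]; first by rewrite muln0 leqn0 muln_eq0.
nia.
Qed.

(** The new value at s is always lo s, so only the old one is counted. If w is unchanged, the old
    value was within M of it. If w is in the boundary of [S], w was good at the start, and the last
    clause of [resampled] remembers that the old value lies in [lo w - M, hi w + M], which has at
    most 4M + 1 points. *)
Lemma inner_step (X : seq V) (s w : V) : s \in S -> s \notin X ->
  w \in nb s -> w \notin X \/ w \in dS ->
  (ncard (Phi X) <= (4 * M).+1 * ncard (Phi (s :: X)))%N.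
Proof.
move=> sS sX ws hw.
have wD : w \in with_boundary U by exact: dom_nb (SU sS) ws.
have sw : w != s by apply: contraTneq ws => ->; have [_ ->] := sg s.
rewrite -[X in (X <= _)%N]mul1n -[1%N](size_iv (lo s) 1).
apply: (@resample _ _ _ s); rewrite ?uniq_iv//; try exact: finite_resampled.
  have [wdS|wdS] := boolP (w \in dS).
    move=> f; exists (iv (lo w - M%:Z) (4 * M).+1); first by rewrite size_iv.
    move=> y [_ [_ _ _ fr]]; have := fr s w sS sX wdS ws.
    by rewrite /upd eqxx mem_iv; have := lohi w; lia.
  have wX : w \notin X by case: hw => //; rewrite (negbTE wdS).
  move=> f; exists (iv (f w - M%:Z) (4 * M).+1); first by rewrite size_iv.
  move=> y [_ [_ fl _ _]]; have := fl s w (dom_sub (SU sS)) wD sX wX ws.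
  by rewrite /upd eqxx (negbTE sw) mem_iv; lia.
move=> f z Pf; rewrite mem_iv => hz; apply: resampled_upd => //.
  by rewrite mem_cat sS.
by have := lohi s; lia.
Qed.

Lemma eq_resampled X Y : X =i Y -> Phi X = Phi Y.
Proof.
move=> XY; apply/seteqP; split=> f [[f0 fL fb fX] [fg fl fbad fr]]; split; split=> //.
- by move=> v; rewrite -XY; exact: fX.
- by move=> u v; rewrite -!XY; exact: fl.
- by move=> v; rewrite -XY => ? ?; exact: fbad.
- by move=> s w; rewrite -XY => ? ?; exact: fr.
- by move=> v; rewrite XY; exact: fX.
- by move=> u v; rewrite !XY; exact: fl.
- by move=> v; rewrite XY => ? ?; exact: fbad.
- by move=> s w; rewrite XY => ? ?; exact: fr.
Qed.

Lemma boundary_resample (X : seq V) : uniq X -> {subset X <= dS} ->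
  ((2 * M).+1 ^ size X * ncard (Phi [::]) <= (2 * M) ^ size X * ncard (Phi X))%N.
Proof.
elim: X => [|w X IH] //= /andP[wX uX] sX.
have {}IH := IH uX (fun x xX => sX x (@mem_behead _ (w :: X) x xX)).
have := @boundary_step X w (sX w (mem_head _ _)) wX (fun x xX => sX x (@mem_behead _ (w :: X) x xX)).
rewrite !expnS => h.
rewrite -mulnA (leq_trans (leq_mul (leqnn _) IH))// mulnCA [X in (_ <= X)%N]mulnAC.
by rewrite [X in (_ <= X)%N]mulnC leq_mul2l h orbT.
Qed.

(** The last vertex of [T] to be resampled is one with a neighbour w outside [T]: then w is in the
    boundary of [S] or still has its old value, as [inner_step] requires. *)
Lemma inner_resample (n : nat) (T : seq V) : size T = n -> uniq T -> {subset T <= S} ->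
  (ncard (Phi dS) <= (4 * M).+1 ^ n * ncard (Phi (T ++ dS)))%N.
Proof.
elim: n T => [|n IH] T sT uT TS.
  by move/size0nil: sT => ->; rewrite expn0 mul1n.
have T0 : T != [::] by rewrite -size_eq0 sT.
have [s [w [sT' wT ws]]] := exit T0.
have := IH (rem s T); rewrite size_rem// sT => /(_ erefl (rem_uniq _ uT)).
have remT x : (x \in rem s T) = (x != s) && (x \in T) by rewrite mem_rem_uniq// inE.
move=> /(_ _)/wrap[x|h]; first by rewrite remT => /andP[_ /TS].
apply: leq_trans h _; rewrite expnSr -mulnA leq_mul2l; apply/orP; right.
have sdS : s \notin dS by apply/negP => /mem_vboundary[]; rewrite TS.
have -> : Phi (T ++ dS) = Phi (s :: (rem s T ++ dS)).
  apply: eq_resampled => x; rewrite inE !mem_cat remT.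
  by case: eqVneq => [->|] //=; rewrite sT'.
apply: inner_step ws _; first exact: TS.
  by rewrite mem_cat remT eqxx/=.
have [|wdS] := boolP (w \in dS); first by right.
by left; rewrite mem_cat remT (negbTE wT) andbF.
Qed.

(** If just one end of an edge was resampled, the other end is within distance 2 of [S], where
    values are good and so compatible with every good value. *)
Lemma resampled_conf : Phi (S ++ dS) `<=` conf U.
Proof.
move=> f [[f0 fL fb fX] [fg fl fbad fr]]; split=> // u v uD vD uv.
have [uX|uX] := boolP (u \in S ++ dS); have [vX|vX] := boolP (v \in S ++ dS).
- by apply: (gd_gd uv); exact: fX.
- apply: (gd_gd uv (fX _ uX)); move: uX; rewrite mem_cat => /orP[uS|].
    have : v \in with_boundary S by exact: dom_nb uS uv.
    by rewrite /with_boundary (negbTE vX).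
  move: vX; rewrite mem_cat negb_or => /andP[vS _] /mem_vboundary[uS [s sS us]].
  by apply: (fg v s) => //; apply: (nb2_nb us uv); apply: contraNneq vS => ->.
- apply: (gd_gd uv _ (fX _ vX)); move: vX; rewrite mem_cat => /orP[vS|].
    have : u \in with_boundary S by apply: dom_nb vS _; rewrite nb_sym.
    by rewrite /with_boundary (negbTE uX).
  move: uX; rewrite mem_cat negb_or => /andP[uS _] /mem_vboundary[vS [s sS vs]].
  apply: (fg u s) => //; apply: (nb2_nb vs); first by rewrite -nb_sym.
  by apply: contraNneq uS => ->.
- exact: fl.
Qed.

End Cluster.

Lemma peierls (U S : seq V) : uniq S -> {subset S <= U} ->
  ((2 * M).+1 ^ size (vboundary nb S) * ncard (clust U S) <=
   (2 * M) ^ size (vboundary nb S) * ((4 * M).+1 ^ size S * ncard (conf U)))%N.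
Proof.
move=> uS SU.
have [L0 hL0] := conf_bound U.
have [L1 hL1] := bounded_on (with_boundary U) lo.
have [L2 hL2] := bounded_on (with_boundary U) hi.
(* This covers the old values and the phase ends, so all intermediate functions stay in one finite
   box. *)
pose L := (L0 + L1 + L2)%N.
have h1 v : v \in with_boundary U -> (`|lo v| <= L)%N by move=> /hL1; rewrite /L; lia.
have h2 v : v \in with_boundary U -> (`|hi v| <= L)%N by move=> /hL2; rewrite /L; lia.
have A1 : (ncard (clust U S) <= ncard (resampled U S L [::]))%N.
  apply: ncard_sub; first exact: finite_resampled.
  move=> f [cf fbad fg]; have [f0 fl fb] := cf; split; split=> //.
  - by move=> v; have := hL0 f cf v; rewrite /L; lia.
  - by move=> u v uD vD _ _; exact: fl.
  - by move=> s sS _; exact: fbad.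
  move=> s w sS _ wdS ws; have /mem_vboundary[wS _] := wdS.
  have wD := dom_nb (SU _ sS) ws.
  have := fg w s wD wS sS (nb_nb2 ws).
  by have := fl s w (dom_sub (SU _ sS)) wD ws; rewrite /in_phase; lia.
apply: leq_trans (leq_mul (leqnn _) A1) _.
apply: leq_trans (boundary_resample SU h1 h2 (undup_uniq _) (fun _ => id)) _.
apply: leq_mul => //.
apply: leq_trans (inner_resample SU h1 h2 (erefl _) uS (fun _ => id)) _.
apply: leq_mul => //; apply: ncard_sub; first exact: finite_conf.
exact: resampled_conf.
Qed.

End Peierls.

(** * Clusters and walks *)

Section Reach.
Variables (V : eqType) (nb : V -> seq V).
Hypothesis sg : simple_graph nb.

(** Only the vertices after the start have to satisfy [B]; x is reached in any case. *)
Inductive reach (B : pred V) (x : V) : V -> Prop :=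
| reach_refl : reach B x x
| reach_step u v : reach B x u -> v \in nb2 nb u -> B v -> reach B x v.

Lemma reach_sub (B B' : pred V) x v : {subset B <= B'} -> reach B x v -> reach B' x v.
Proof.
move=> BB'; elim=> [|u w _ IH wu Bw]; first exact: reach_refl.
by apply: reach_step IH wu _; exact: BB'.
Qed.

Lemma reach_in (B : pred V) x v : reach B x v -> v = x \/ B v.
Proof. by case=> [|u w _ _]; [left|right]. Qed.

Fixpoint walks (n : nat) (v : V) : seq (seq V) :=
  if n is n'.+1 then flatten [seq [seq w :: p | p <- walks n' w] | w <- nb2 nb v]
  else [:: [::]].

Lemma mem_walks v p : path (fun u w => w \in nb2 nb u) v p -> p \in walks (size p) v.
Proof.
elim: p v => [|w p IH] v //= /andP[wv pw].
by apply/flatten_mapP; exists w => //; rewrite map_f// IH.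
Qed.

Lemma size_walks d : (forall v, size (nb v) <= d)%N ->
  forall n v, (size (walks n v) <= (d ^ 2) ^ n)%N.
Proof.
move=> nbd.
have nb2d v : (size (nb2 nb v) <= d ^ 2)%N.
  rewrite /nb2 size_flatten /shape -map_comp sumnE big_map.
  apply: (@leq_trans (\sum_(w <- nb v) d)%N).
    rewrite big_seq [X in (_ <= X)%N]big_seq; apply: leq_sum => w wv /=; rewrite size_rem; last by rewrite (nb_sym sg).
    have : (0 < size (nb w))%N by rewrite -has_predT; apply/hasP; exists v; rewrite // (nb_sym sg).
    by move=> h; rewrite prednK.
  by rewrite big_const_seq count_predT iter_addn_0 expnS expn1 leq_mul2l nbd orbT.
elim=> [|n IH] v //=.
rewrite size_flatten /shape -map_comp sumnE big_map.
apply: (@leq_trans (\sum_(w <- nb2 nb v) (d ^ 2) ^ n)%N).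
  by apply: leq_sum => w _ /=; rewrite size_map.
by rewrite big_const_seq count_predT iter_addn_0 (expnSr (d ^ 2)) leq_mul2l nb2d orbT.
Qed.

Lemma size_walks_mem n v p : p \in walks n v -> size p = n.
Proof.
elim: n v p => [|n IH] v p /=; first by rewrite inE => /eqP->.
by move=> /flatten_mapP[w _ /mapP[q /IH <- ->]].
Qed.

(* Traversing each newly discovered edge back and forth visits the whole
   cluster in twice as many steps as it has vertices. *)
Lemma reach_walk (B : pred V) x (s : seq V) : (forall v, reach B x v -> v \in s) ->
  exists p, [/\ path (fun u w => w \in nb2 nb u) x p,
    forall v, reach B x v <-> v \in x :: p &
    size p = 2 * (size (undup (x :: p))).-1]%N.
Proof.
move=> Bs.
suff main n p : path (fun u w => w \in nb2 nb u) x p ->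
    (forall v, v \in x :: p -> reach B x v) ->
    (size p = 2 * (size (undup (x :: p))).-1)%N ->
    (size (undup s) - size (undup (x :: p)) <= n)%N ->
    exists p, [/\ path (fun u w => w \in nb2 nb u) x p,
    forall v, reach B x v <-> v \in x :: p &
    size p = 2 * (size (undup (x :: p))).-1]%N.
  apply: (main (size (undup s)) [::]) => //=.
    by move=> v; rewrite inE => /eqP->; exact: reach_refl.
  exact: leq_subr.
elim: n p => [|n IH] p pp pr ps pn.
all: have [all_in|] := pselect (forall v, reach B x v -> v \in x :: p);
  first by exists p; split=> // v; split=> [/all_in|/pr].
all: move=> /existsNP[v /not_implyP[rv /negP vp]].
all: have [u [w [up wp wu rw]]] : exists u w, [/\ u \in x :: p, w \notin x :: p,
    w \in nb2 nb u & reach B x w]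
  by elim: rv vp => [|u w ru IHu wu Bw wp]; [rewrite mem_head|
     have [up|/IHu//] := boolP (u \in x :: p); exists u, w; split=> //;
     exact: reach_step ru wu Bw].
all: have sz : size (undup (w :: x :: p)) = (size (undup (x :: p))).+1
  by rewrite [undup (w :: _)]/= (negbTE wp).
all: have szs : (size (undup (w :: x :: p)) <= size (undup s))%N
  by apply: uniq_leq_size (undup_uniq _) _ => z; rewrite !mem_undup inE =>
    /orP[/eqP->|/pr]; exact: Bs.
  by move: szs pn; rewrite sz; lia.
have [p1 [p2 [pE lu]]] : exists p1 p2, p = p1 ++ p2 /\ last x p1 = u.
  by case/splitPl: up => p1 p2 lp; exists p1, p2; rewrite lp.
(* A detour from u to w and back is inserted at a visit of u. *)
pose p' := p1 ++ w :: u :: p2.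
have p'E : x :: p' =i w :: x :: p.
  move=> z; rewrite /p' pE !inE !mem_cat !inE.
  have uin : u \in x :: p1 by rewrite -lu mem_last.
  move: uin; rewrite inE.
  have [->|_] := eqVneq z u.
    by case/orP => ->; rewrite !orbT.
  by move=> _; case: (z == x); case: (z == w); case: (z \in p1).
have p's : size (undup (x :: p')) = (size (undup (x :: p))).+1.
  rewrite -sz; apply/perm_size/uniq_perm; rewrite ?undup_uniq// => z.
by rewrite !mem_undup p'E.
apply: (IH p').
- move: pp; rewrite /p' pE !cat_path /= lu => /andP[-> ->]; rewrite wu /=.
  by rewrite (nb2_sym sg wu).
- by move=> z; rewrite p'E inE => /orP[/eqP->|/pr].
- have : (0 < size (undup (x :: p)))%N.
    by rewrite -has_predT; apply/hasP; exists x; rewrite ?mem_undup ?mem_head.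
  move: ps; rewrite p's; move: (size (undup _)) => N.
  by rewrite /p' pE !size_cat [size (w :: _)]/=; lia.
by move: pn szs; rewrite p's sz; lia.
Qed.

End Reach.

(** * Exchanging two samples *)

Section Swap.
Variables (V : eqType) (nb : V -> seq V) (M : nat) (lo hi : V -> int).
Hypothesis sg : simple_graph nb.
Hypothesis lohi : forall v, lo v <= hi v <= lo v + 2 * M%:Z.
Hypothesis hilo : forall u v, v \in nb u -> hi u = lo v + M%:Z.
Hypothesis exit : forall S : seq V, S != [::] ->
  exists s w, [/\ s \in S, w \notin S & w \in nb s].
Variables (F : seq V) (o : V).
Hypothesis F_conn : forall v, v \in F -> reach nb (mem F) o v.

Local Notation conf := (conf nb M lo hi).
Local Notation gd := (in_phase lo hi).

Definition out_of_phase (U : seq V) (f : V -> int) : pred V :=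
  fun v => (v \in with_boundary nb U) && ~~ gd f v.

(** Counting [F] as bad forces the cluster of o to contain [F], so that the exchange swaps the two
    samples there. *)
Definition pairbad (U U' : seq V) (f f' : V -> int) : pred V :=
  fun v => [|| out_of_phase U f v, out_of_phase U' f' v | v \in F].

Definition cluster (U U' : seq V) (f f' : V -> int) (v : V) : Prop :=
  reach nb (pairbad U U' f f') o v.

Definition touched (U U' : seq V) (f f' : V -> int) (v : V) : Prop :=
  cluster U U' f f' v \/ exists2 u, cluster U U' f f' u & v \in nb u.

Definition confined (U U' : seq V) (f f' : V -> int) : Prop :=
  forall v, touched U U' f f' v -> v \in U /\ v \in U'.

Definition mix (T : V -> Prop) (g f : V -> int) : V -> int :=
  fun v => if `[< T v >] then g v else f v.

Lemma pairbadC U U' f f' : pairbad U U' f f' = pairbad U' U f' f.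
Proof. by apply/funext => v; rewrite /pairbad orbCA. Qed.

Lemma touchedC U U' f f' : touched U U' f f' = touched U' U f' f.
Proof. by rewrite /touched /cluster pairbadC. Qed.

Lemma confinedC U U' f f' : confined U U' f f' -> confined U' U f' f.
Proof. by rewrite /confined touchedC => h v /h[]. Qed.

Lemma bad_sub U f v : conf U f -> out_of_phase U f v -> v \in U.
Proof.
move=> [_ _ fb] /andP[]; rewrite mem_cat => /orP[//|/fb].
by rewrite /gd => ->.
Qed.

Lemma cluster_sub U U' f f' v : conf U f -> conf U' f' ->
  cluster U U' f f' v -> v \in o :: U ++ U' ++ F.
Proof.
move=> cf cf' /reach_in[->|]; first by rewrite mem_head.
rewrite inE !mem_cat => /or3P[/(bad_sub cf)->|/(bad_sub cf')->|->];
  by rewrite !orbT.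
Qed.

Lemma F_cluster U U' f f' v : v \in F -> cluster U U' f f' v.
Proof.
move=> /F_conn; apply: reach_sub => w wF.
by apply/or3P; apply: Or33.
Qed.

Lemma cluster_closed U U' f f' u v : cluster U U' f f' u -> v \in nb2 nb u ->
  pairbad U U' f f' v -> cluster U U' f f' v.
Proof. exact: reach_step. Qed.

(** A confined exchange takes place inside both volumes, so the boundary values stay; the only edges
    to check are those leaving the touched set. *)
Lemma mix_conf U U' f f' : conf U f -> conf U' f' -> confined U U' f f' ->
  conf U (mix (touched U U' f f') f' f).
Proof.
move=> [f0 fl fb] [f0' fl' fb'] hT; set T := touched _ _ _ _.
(* An edge leaving the touched set joins vertices at distance 1 and 2 from the
   cluster, where both functions take good values. *)
have cross u v : u \in with_boundary nb U -> v \in with_boundary nb U -> v \in nb u -> T u -> ~ T v ->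
    `|f' u - f v| <= M%:Z.
  move=> uD vD uv Tu nTv.
  have [uU uU'] := hT _ Tu.
  have ncu : ~ cluster U U' f f' u by move=> cu; apply: nTv; right; exists u.
  have ncv : ~ cluster U U' f f' v by move=> cv; apply: nTv; left.
  case: Tu => [//|[w cw wu]].
  have /norP[_ /norP[]] : ~~ pairbad U U' f f' u.
    by apply/negP => bu; apply: ncu; exact: cluster_closed cw (nb_nb2 sg wu) bu.
  rewrite /out_of_phase (dom_sub _ uU') /= negbK => gu _.
  have vw : v != w by apply/eqP => vw; apply: ncv; rewrite vw.
  have /norP[] : ~~ pairbad U U' f f' v.
    apply/negP => bv; apply: ncv; apply: cluster_closed cw _ bv.
    exact: (nb2_nb sg wu uv vw).
  rewrite /out_of_phase vD /= negbK => gv _.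
  exact: (gd_gd sg hilo uv gu gv).
split.
- move=> v vD; rewrite /mix; case: asboolP => [/hT[vU _]|_]; last exact: f0.
  by move: vD; rewrite (dom_sub _ vU).
- move=> u v uD vD uv; rewrite /mix.
  case: asboolP => Tu; case: asboolP => Tv.
  + by have [_ /dom_sub uU] := hT _ Tu; have [_ /dom_sub vU] := hT _ Tv; exact: fl'.
  + exact: cross.
  + by rewrite distrC; apply: cross => //; move: uv; rewrite /adj (nb_sym sg).
  + exact: fl.
- move=> v vb; rewrite /in_phase /mix; case: asboolP => [/hT[vU _]|_]; last exact: fb.
  by move/mem_vboundary: vb => -[]; rewrite vU.
Qed.

(** Being bad for one of the two samples is symmetric in them, and an exchange at a vertex of both
    volumes preserves it. Hence the cluster is unchanged and the exchange is an involution. *)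
Lemma mix_pairbad U U' f f' : confined U U' f f' ->
  let T := touched U U' f f' in
  pairbad U U' (mix T f' f) (mix T f f') = pairbad U U' f f'.
Proof.
move=> hT T; apply/funext => v; rewrite /pairbad /out_of_phase /in_phase /mix.
case: asboolP => // /hT[vU vU'].
by rewrite (dom_sub _ vU) (dom_sub _ vU') /= orbCA.
Qed.

Lemma mix_touched U U' f f' : confined U U' f f' ->
  let T := touched U U' f f' in
  touched U U' (mix T f' f) (mix T f f') = T.
Proof. by move=> hT T; rewrite /touched /cluster mix_pairbad. Qed.

Definition swap (U U' : seq V) (x : (V -> int) * (V -> int)) :=
  let T := touched U U' x.1 x.2 in (mix T x.2 x.1, mix T x.1 x.2).

Definition conf_pairs (U U' : seq V) : set ((V -> int) * (V -> int)) :=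
  conf U `*` conf U'.

Lemma swapK U U' x : confined U U' x.1 x.2 -> swap U U' (swap U U' x) = x.
Proof.
case: x => f f' /= cx; rewrite /swap /= mix_touched//.
by congr pair; apply/funext => v; rewrite /mix; case: asboolP.
Qed.

Lemma finite_pairs U U' : finite_set (conf_pairs U U').
Proof. by apply: finite_setX; exact: finite_conf. Qed.

Lemma swap_pairs U U' x : conf_pairs U U' x -> confined U U' x.1 x.2 ->
  conf_pairs U U' (swap U U' x) /\ confined U U' (swap U U' x).1 (swap U U' x).2.
Proof.
case: x => f f' [/= cf cf'] hT; split; [split|] => /=.
- exact: mix_conf.
- by rewrite touchedC; apply: mix_conf => //; exact: confinedC.
- by rewrite /confined mix_touched.
Qed.

Definition depends_on (D : seq V) (E : set (V -> int)) :=
  forall f g, (forall v, v \in D -> f v = g v) -> E f -> E g.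

Lemma swap_F U U' x v : v \in F ->
  (swap U U' x).1 v = x.2 v /\ (swap U U' x).2 v = x.1 v.
Proof.
move=> vF; rewrite /swap /mix /=; case: asboolP => // -[].
by left; exact: F_cluster.
Qed.

Local Open Scope nat_scope.

(** On confined pairs the exchange is injective, and since [F] lies in the cluster it carries the
    event for one sample to the event for the other. *)
Lemma swap_ncard U U' (E : set (V -> int)) : depends_on F E ->
  ncard (conf_pairs U U' `&` [set x | E x.1 /\ confined U U' x.1 x.2]) =
  ncard (conf_pairs U U' `&` [set x | E x.2 /\ confined U U' x.1 x.2]).
Proof.
move=> dE.
have fin A : finite_set (conf_pairs U U' `&` A) by apply: finite_setIl; exact: finite_pairs.
have inj A : {in conf_pairs U U' `&` [set x | A x /\ confined U U' x.1 x.2] &,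
    injective (swap U U')}.
  by move=> x y; rewrite !inE => -[_ [_ cx]] [_ [_ cy]] /(congr1 (swap U U')); rewrite !swapK.
apply/eqP; rewrite eqn_leq; apply/andP; split.
  apply: (@ncard_inj _ _ (swap U U'));
    [exact: fin|exact: (inj (fun x => E x.1))|move=> x [px [Ex cx]]].
  have [ps cs] := swap_pairs px cx; split=> //; split=> //.
  by apply: dE Ex => v vF; have [_ ->] := swap_F U U' x vF.
apply: (@ncard_inj _ _ (swap U U'));
  [exact: fin|exact: (inj (fun x => E x.2))|move=> x [px [Ex cx]]].
have [ps cs] := swap_pairs px cx; split=> //; split=> //.
by apply: dE Ex => v vF; have [-> _] := swap_F U U' x vF.
Qed.

(** Divided by the number of pairs: the probabilities of [E] in the two volumes differ by at most
    the probability that a pair is not confined. *)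
Lemma swap_close U U' (E : set (V -> int)) : depends_on F E ->
  let esc := ncard (conf_pairs U U' `&` [set x | ~ confined U U' x.1 x.2]) in
  ncard (conf U `&` E) * ncard (conf U') <=
    ncard (conf U) * ncard (conf U' `&` E) + esc /\
  ncard (conf U) * ncard (conf U' `&` E) <=
    ncard (conf U `&` E) * ncard (conf U') + esc.
Proof.
move=> dE esc.
have fc W := finite_conf M lo hi exit W.
have fin A : finite_set (conf_pairs U U' `&` A) by apply: finite_setIl; exact: finite_pairs.
have e1 : ncard (conf U `&` E) * ncard (conf U') =
    ncard (conf_pairs U U' `&` [set x | E x.1]).
  rewrite -ncardX//; last exact: finite_setIl.
  by congr ncard; apply/seteqP; split=> -[f f'] /=; rewrite /conf_pairs /setX /=; tauto.
have e2 : ncard (conf U) * ncard (conf U' `&` E) =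
    ncard (conf_pairs U U' `&` [set x | E x.2]).
  rewrite -ncardX//; last exact: finite_setIl.
  by congr ncard; apply/seteqP; split=> -[f f'] /=; rewrite /conf_pairs /setX /=; tauto.
have split_conf (A : set ((V -> int) * (V -> int))) :
    ncard (conf_pairs U U' `&` [set x | A x /\ confined U U' x.1 x.2])
    <= ncard (conf_pairs U U' `&` A)
    <= ncard (conf_pairs U U' `&` [set x | A x /\ confined U U' x.1 x.2]) + esc.
  apply/andP; split; first by apply: ncard_sub => // x [px [Ax _]].
  apply: leq_trans (ncardU _ _) => //; apply: ncard_sub; first by rewrite finite_setU.
  move=> x [px Ax]; have [cx|cx] := pselect (confined U U' x.1 x.2); [left|right];
    by split.
have /andP[a1 a2] := split_conf (fun x => E x.1).
have /andP[b1 b2] := split_conf (fun x => E x.2).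
have sw := swap_ncard U U' dE.
rewrite e1 e2; split.
  by apply: leq_trans a2 _; rewrite leq_add2r sw.
by apply: leq_trans b2 _; rewrite leq_add2r -sw.
Qed.

End Swap.

(** * Large clusters are unlikely *)

Section Subseqs.
Variable T : eqType.
Fixpoint subseqs (s : seq T) : seq (seq T) :=
  if s is x :: s' then map (cons x) (subseqs s') ++ subseqs s' else [:: [::]].

Lemma filter_subseqs (p : pred T) s : seq.filter p s \in subseqs s.
Proof.
elim: s => [|x s IH] //=; rewrite mem_cat.
by case: ifP => _; rewrite ?map_f// IH orbT.
Qed.

Lemma size_subseqs s : size (subseqs s) = (2 ^ size s)%N.
Proof. by elim: s => [|x s IH] //=; rewrite size_cat size_map IH expnS; lia. Qed.

Lemma subseqs_subseq s t : t \in subseqs s -> subseq t s.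
Proof.
elim: s t => [|x s IH] t; first by rewrite inE => /eqP->.
rewrite [subseqs _]/= mem_cat => /orP[/mapP[u /IH us ->]|/IH ts].
  by rewrite /= eqxx.
exact: subseq_trans ts (subseq_cons _ _).
Qed.
End Subseqs.

Lemma count_predU_le (T : eqType) (a b : pred T) (s : seq T) :
  (count (predU a b) s <= count a s + count b s)%N.
Proof. by rewrite -count_predUI leq_addr. Qed.

Lemma count_mem_le (T : eqType) (F s : seq T) :
  uniq s -> (count (mem F) s <= size F)%N.
Proof.
move=> us; rewrite -size_filter; apply: uniq_leq_size; first exact: filter_uniq.
by move=> v; rewrite mem_filter => /andP[].
Qed.

Lemma geo_sum (R : realFieldType) (r : R) n m : 0 <= r <= 2^-1 ->
  \sum_(k <- iota n m) r ^+ k <= 2 * r ^+ n.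
Proof.
move=> /andP[r0 r1]; elim: m n => [|m IH] n /=.
  by rewrite big_nil mulr_ge0// exprn_ge0.
rewrite big_cons; have := IH n.+1; have : 0 <= r ^+ n by rewrite exprn_ge0.
rewrite exprS => h1 h2; nra.
Qed.

Section Tail.
Variables (R : realType) (V : eqType) (nb : V -> seq V) (M : nat) (lo hi : V -> int).
Hypothesis sg : simple_graph nb.
Hypothesis lohi : forall v, lo v <= hi v <= lo v + 2 * M%:Z.
Hypothesis hilo : forall u v, v \in nb u -> hi u = lo v + M%:Z.
Hypothesis exit : forall S : seq V, S != [::] ->
  exists s w, [/\ s \in S, w \notin S & w \in nb s].
Variables (d : nat) (q : R).
Hypothesis nbd : forall v, (size (nb v) <= d)%N.
Hypothesis d_gt0 : (0 < d)%N.
Hypothesis q01 : 0 < q <= 1.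
Hypothesis clust_le : forall U S : seq V, uniq S -> {subset S <= U} ->
  (ncard (clust nb M lo hi U S))%:R <= q ^+ size S * (ncard (conf nb M lo hi U))%:R.
Local Notation r := (4 * d%:R ^+ 4 * q).
Hypothesis r_le : r <= 2^-1.
Variable o : V.

Local Notation conf := (conf nb M lo hi).
Local Notation gd := (in_phase lo hi).
Local Notation bad := (out_of_phase nb lo hi).
Local Notation c U := ((ncard (conf U))%:R : R).
Local Notation pairs := (conf_pairs nb M lo hi).

Lemma ncard_conf_gt0R U : 0 < c U.
Proof. by rewrite ltr0n; exact: ncard_conf_gt0. Qed.

(** * Union bound over the clusters of a pair of samples *)

Section Pair.
Variables (F U U' : seq V).
Local Notation cluster := (cluster nb lo hi F o U U').

(** The cluster is closed under steps to bad vertices, so a vertex that is bad for f and within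
    distance 2 of the bad part belongs to that part. *)
Lemma cluster_clust (s : seq V) (f f' : V -> int) : conf U f ->
  (forall v, cluster f f' v <-> v \in s) -> clust nb M lo hi U (seq.filter (bad U f) s) f.
Proof.
move=> cf Ks; split=> //.
  by move=> v; rewrite mem_filter => /andP[/andP[_]].
move=> v u vU; rewrite !mem_filter => nv /andP[bu us] vu.
apply: contraNT nv => gv; have bv : bad U f v by rewrite /out_of_phase vU.
rewrite bv /=; apply/Ks; apply: cluster_closed vu _; first exact/Ks.
by rewrite /pairbad bv.
Qed.

(** The parts of s that are bad for the first and for the second sample are chosen in at most 4^|s|
    ways, and for each choice the Peierls bounds multiply. Up to [j0] vertices of s may be good for
    both; the factor q^j0 on the left pays for them. *)
Lemma one_cluster (A : set ((V -> int) * (V -> int))) (s : seq V) j0 :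
  A `<=` pairs U U' -> uniq s ->
  (forall x, A x -> (forall v, cluster x.1 x.2 v <-> v \in s) /\
    (size s <= count (bad U x.1) s + count (bad U' x.2) s + j0)%N) ->
  (ncard A)%:R * q ^+ j0 <= (4 * q) ^+ size s * (c U * c U').
Proof.
move=> AX us Acl; have /andP[q0 q1] := q01; have q0' := ltW q0.
have cc0 : 0 <= c U * c U' by rewrite mulr_ge0.
have fA : finite_set A by apply: sub_finite_set AX _; exact: finite_pairs.
pose I := [seq (S1, S2) | S1 <- subseqs s, S2 <- subseqs s].
pose G (i : seq V * seq V) := [set x : (V -> int) * (V -> int) |
  [/\ clust nb M lo hi U i.1 x.1 /\ clust nb M lo hi U' i.2 x.2,
     {subset i.1 <= U}, {subset i.2 <= U'} & (size s <= size i.1 + size i.2 + j0)%N]].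
have cov : (ncard A <= \sum_(i <- I) ncard (A `&` G i))%N.
  apply: ncard_cover fA _ => x Ax.
  have [Kx sx] := Acl _ Ax; have [cf cf'] := AX _ Ax.
  exists (seq.filter (bad U x.1) s, seq.filter (bad U' x.2) s).
    by apply/allpairsP; exists (seq.filter (bad U x.1) s, seq.filter (bad U' x.2) s);
      rewrite /= !filter_subseqs.
  split=> /=.
  - split; first exact: (cluster_clust cf Kx).
    split=> //; first by move=> v; rewrite mem_filter => /andP[/andP[_]].
    move=> v u vU; rewrite !mem_filter => nv /andP[bu us'] vu.
    apply: contraNT nv => gv; have bv : bad U' x.2 v by rewrite /out_of_phase vU.
    rewrite bv /=; apply/Kx; apply: cluster_closed vu _; first exact/Kx.
    by rewrite /pairbad bv orbT.
  - by move=> v; rewrite mem_filter => /andP[/(bad_sub cf)].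
  - by move=> v; rewrite mem_filter => /andP[/(bad_sub cf')].
  - by rewrite !size_filter.
have term i : i \in I -> (ncard (A `&` G i))%:R * q ^+ j0 <= q ^+ size s * (c U * c U').
  case: i => S1 S2 /allpairsP[[? ?] /= [s1 s2 [e1 e2]]].
  rewrite -{}e1 in s1; rewrite -{}e2 in s2.
  have [[S1U S2U sz]|no] := pselect ([/\ {subset S1 <= U}, {subset S2 <= U'} &
      (size s <= size S1 + size S2 + j0)%N]); last first.
    rewrite (_ : A `&` _ = set0) ?ncard0 ?mul0r ?mulr_ge0 ?exprn_ge0//.
    by rewrite -subset0 => x [_ [_ a b e]]; apply: no.
  have u1 : uniq S1 by apply: subseq_uniq us; exact: subseqs_subseq.
  have u2 : uniq S2 by apply: subseq_uniq us; exact: subseqs_subseq.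
  have fcl W S : finite_set (clust nb M lo hi W S).
    by apply: sub_finite_set (finite_conf M lo hi exit W) => f [].
  have le1 : (ncard (A `&` G (S1, S2)))%:R <=
      (ncard (clust nb M lo hi U S1))%:R * (ncard (clust nb M lo hi U' S2))%:R :> R.
    rewrite -natrM ler_nat -ncardX//; apply: ncard_sub; first exact: finite_setX.
    by move=> x [_ []].
  have le2 := ler_pM (ler0n _ _) (ler0n _ _) (clust_le u1 S1U) (clust_le u2 S2U).
  apply: (@le_trans _ _ (q ^+ (size S1 + size S2 + j0) * (c U * c U'))).
    rewrite exprD [X in _ <= X]mulrAC ler_pM2r ?exprn_gt0//.
    by apply: (le_trans le1); apply: (le_trans le2); rewrite mulrACA exprD.
  by rewrite ler_wpM2r//; apply: ler_wiXn2l => //; exact: ltW.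
apply: (@le_trans _ _ ((\sum_(i <- I) ncard (A `&` G i))%:R * q ^+ j0)).
  by rewrite ler_wpM2r ?exprn_ge0// ler_nat.
rewrite natr_sum big_distrl /=.
apply: (@le_trans _ _ (\sum_(i <- I) q ^+ size s * (c U * c U'))).
  rewrite big_seq [X in _ <= X]big_seq; apply: ler_sum => i; exact: term.
rewrite big_const_seq count_predT iter_addr_0 size_allpairs size_subseqs.
rewrite -expnMn -[X in X <= _]mulr_natl natrX exprMn mulrA.
by [].
Qed.

(** A cluster of k vertices is traced by one of at most (d^4)^(k-1) walks, so its weight is at most
    r^k / d^4. The factor d^4 stands on the left, and the sum over k >= [n0] is geometric; [0 < n0]
    keeps the exponent k - 1 exact. *)
Lemma cluster_tail (A : set ((V -> int) * (V -> int))) n0 j0 : (0 < n0)%N ->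
  A `<=` pairs U U' ->
  (forall x s, A x -> uniq s -> (forall v, cluster x.1 x.2 v <-> v \in s) ->
    (n0 <= size s)%N /\
    (size s <= count (bad U x.1) s + count (bad U' x.2) s + j0)%N) ->
  (ncard A)%:R * (d%:R ^+ 4 * q ^+ j0) <= 2 * r ^+ n0 * (c U * c U').
Proof.
move=> n0_gt0 AX Acl; have /andP[q0 q1] := q01; have q0' := ltW q0.
have cc0 : 0 <= c U * c U' by rewrite mulr_ge0.
have fA : finite_set A by apply: sub_finite_set AX _; exact: finite_pairs.
pose L := o :: U ++ U' ++ F.
(* Clusters lie in [L], so their sizes fall in this finite range. *)
pose I := iota n0 (size L).+1.
pose Fp (p : seq V) := [set x : (V -> int) * (V -> int) |
  (forall v, cluster x.1 x.2 v <-> v \in o :: p) /\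
  (size p = 2 * (size (undup (o :: p))).-1)%N].
have cov : (ncard A <= \sum_(p <- flatten [seq walks nb (2 * k.-1) o | k <- I])
    ncard (A `&` Fp p))%N.
  apply: ncard_cover fA _ => x Ax; have [cf cf'] := AX _ Ax.
  have Kl v : cluster x.1 x.2 v -> v \in o :: U ++ U' ++ F by exact: (cluster_sub cf cf').
  have [p [pp Kp sp]] := @reach_walk _ _ sg (pairbad nb lo hi F U U' x.1 x.2) o _ Kl.
  exists p => //.
  have Kp' v : cluster x.1 x.2 v <-> v \in undup (o :: p).
    by rewrite mem_undup; exact: Kp.
  have [n0s _] := Acl x _ Ax (undup_uniq _) Kp'.
  apply/flatten_mapP; exists (size (undup (o :: p))); last first.
    by rewrite -sp; exact: mem_walks.
  rewrite mem_iota n0s.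
  have : (size (undup (o :: p)) <= size L)%N.
    apply: uniq_leq_size; first exact: undup_uniq.
    by move=> v /Kp'; exact: Kl.
  by move: (size L) (size _) => ? ?; lia.
have term k p : k \in I -> p \in walks nb (2 * k.-1) o ->
    (ncard (A `&` Fp p))%:R * q ^+ j0 <= (4 * q) ^+ k * (c U * c U').
  rewrite mem_iota => /andP[k1 _] /size_walks_mem sp.
  have [sk|sk] := eqVneq (size (undup (o :: p))) k; last first.
    rewrite (_ : A `&` _ = set0) ?ncard0 ?mul0r ?mulr_ge0 ?exprn_ge0 ?mulr_ge0//.
    rewrite -subset0 => x [_ [_ sp']].
    have s0 : (0 < size (undup (o :: p)))%N.
      by rewrite -has_predT; apply/hasP; exists o; rewrite ?mem_undup ?mem_head.
    by move: sk; rewrite sp in sp'; lia.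
  rewrite -sk; apply: one_cluster; [by move=> x [/AX]|exact: undup_uniq|].
  move=> x [Ax [Kx _]].
  have Kx' v : cluster x.1 x.2 v <-> v \in undup (o :: p).
    by rewrite mem_undup; exact: Kx.
  split=> //; by have [] := Acl x _ Ax (undup_uniq _) Kx'.
rewrite mulrCA.
apply: (@le_trans _ _ (d%:R ^+ 4 * ((\sum_(p <- flatten [seq walks nb (2 * k.-1) o | k <- I])
    ncard (A `&` Fp p))%:R * q ^+ j0))).
  by apply: ler_wpM2l; rewrite ?exprn_ge0// ler_wpM2r ?exprn_ge0// ler_nat.
rewrite natr_sum big_distrl big_flatten big_map.
apply: (@le_trans _ _ (d%:R ^+ 4 *
   \sum_(k <- I) (d%:R ^+ 4) ^+ k.-1 * ((4 * q) ^+ k * (c U * c U')))).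
  rewrite ler_wpM2l ?exprn_ge0//.
  rewrite big_seq [X in _ <= X]big_seq; apply: ler_sum => k kI.
  apply: (@le_trans _ _ (\sum_(p <- walks nb (2 * k.-1) o) (4 * q) ^+ k * (c U * c U'))).
    rewrite big_seq [X in _ <= X]big_seq; apply: ler_sum => p pW; exact: term.
  rewrite big_const_seq count_predT iter_addr_0 -[X in X <= _]mulr_natl.
  rewrite ler_wpM2r ?mulr_ge0 ?exprn_ge0 ?mulr_ge0//.
  rewrite -!natrX ler_nat; apply: leq_trans (size_walks sg nbd _ _) _.
  by rewrite -!expnM leq_pexp2l//; lia.
rewrite big_distrr /=.
apply: (@le_trans _ _ (\sum_(k <- I) r ^+ k * (c U * c U'))).
  rewrite big_seq [X in _ <= X]big_seq; apply: ler_sum => k; rewrite mem_iota => /andP[k1 _].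
  have -> : r = d%:R ^+ 4 * (4 * q) by rewrite mulrA [d%:R ^+ 4 * 4]mulrC.
  move: (d%:R ^+ 4) => D; case: k k1 => [|k] k1; first by lia.
  by rewrite [(D * _) ^+ _]exprMn [D ^+ k.+1]exprS /= !mulrA.
rewrite -big_distrl /= ler_wpM2r//; apply: geo_sum.
by rewrite r_le !mulr_ge0// ?exprn_ge0//.
Qed.

End Pair.

(** It contains every cluster around o of at most n vertices, together with the neighbours of the
    cluster. *)
Definition walked (n : nat) : seq V :=
  flatten [seq flatten [seq (o :: p) ++ flatten (map nb (o :: p)) | p <- walks nb (2 * k.-1) o]
          | k <- iota 1 n].

Definition finite_prob (U : seq V) (E : set (V -> int)) : R := (ncard (conf U `&` E))%:R / c U.

(** A pair that is not confined must have a cluster of at least n vertices, since smaller ones stay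
    with their neighbours in [walked n]. Cluster vertices outside [F] are bad for one of the
    samples, hence the exponent |F| of q. *)
Lemma pr_close (F U U' : seq V) (E : set (V -> int)) n : (0 < n)%N ->
  o \in F -> (forall v, v \in F -> reach nb (mem F) o v) ->
  {subset walked n <= U} -> {subset walked n <= U'} -> depends_on F E ->
  `|finite_prob U E - finite_prob U' E| <= 2 * r ^+ n / (d%:R ^+ 4 * q ^+ size F).
Proof.
move=> n0 oF Fc RU RU' dE; have /andP[q0 q1] := q01; have q0' := ltW q0.
have d0 : 0 < d%:R :> R by rewrite ltr0n.
set A := pairs U U' `&` [set x | ~ confined nb lo hi F o U U' x.1 x.2].
have tA : (ncard A)%:R * (d%:R ^+ 4 * q ^+ size F) <= 2 * r ^+ n * (c U * c U').
  apply: (@cluster_tail F) => // [x []//|x s [[cf cf'] ncx] us Ks]; split.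
    rewrite leqNgt; apply/negP => sn; apply: ncx.
    have Kl v : cluster nb lo hi F o U U' x.1 x.2 v -> v \in o :: U ++ U' ++ F by exact: (cluster_sub cf cf').
    have [p [pp Kp sp]] := @reach_walk _ _ sg (pairbad nb lo hi F U U' x.1 x.2) o _ Kl.
    have ss : size (undup (o :: p)) = size s.
      apply/perm_size/uniq_perm; rewrite ?undup_uniq// => v; rewrite mem_undup.
      by apply/idP/idP => [/Kp/Ks|/Ks/Kp].
    have inw v : v \in (o :: p) ++ flatten (map nb (o :: p)) -> v \in walked n.
      move=> vp; apply/flatten_mapP; exists (size s).
        rewrite mem_iota; rewrite -ss.
        have : (0 < size (undup (o :: p)))%N.
          by rewrite -has_predT; apply/hasP; exists o; rewrite ?mem_undup ?mem_head.
        by lia.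
      by apply/flatten_mapP; exists p => //; rewrite -ss -sp mem_walks.
    have tw v : touched nb lo hi F o U U' x.1 x.2 v -> v \in walked n.
      move=> tv; apply: inw; rewrite mem_cat; case: tv => [/Kp->//|[u /Kp up vu]].
      by apply/orP; right; apply/flatten_mapP; exists u.
    by move=> v /tw vw; split; [exact: RU|exact: RU'].
  have : all (predU (predU (bad U x.1) (bad U' x.2)) (mem F)) s.
    apply/allP => v /Ks/reach_in[->|]; rewrite /= ?oF ?orbT//.
    by rewrite /pairbad orbA.
  rewrite all_count => /eqP <-; apply: leq_trans (count_predU_le _ _ _) _.
  by apply: leq_add; [exact: count_predU_le|exact: count_mem_le].
have [h1 h2] := swap_close sg hilo exit Fc U U' dE.
have c1 := ncard_conf_gt0R U; have c2 := ncard_conf_gt0R U'.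
rewrite /finite_prob ler_pdivlMr ?mulr_gt0 ?exprn_gt0//.
have -> : (ncard (conf U `&` E))%:R / c U - (ncard (conf U' `&` E))%:R / c U' =
   ((ncard (conf U `&` E))%:R * c U' - c U * (ncard (conf U' `&` E))%:R) / (c U * c U').
  by field; rewrite !gt_eqF.
rewrite normrM normfV (gtr0_norm (mulr_gt0 c1 c2)) mulrAC ler_pdivrMr ?mulr_gt0//.
apply: le_trans tA; rewrite ler_wpM2r ?mulr_ge0 ?exprn_ge0//.
move: h1 h2; rewrite -/A -!(ler_nat R) !natrD !natrM => h1 h2.
by rewrite ler_norml; apply/andP; split; lra.
Qed.

(** The tail bound with both samples in the same volume, [F] empty and sizes from 1 on: if o is bad
    for the first sample, every vertex of its cluster is bad for one of the two. *)
Lemma pr_bad (U : seq V) : finite_prob U [set f | bad U f o] <= 2 * r / d%:R ^+ 4.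
Proof.
have /andP[q0 q1] := q01; have q0' := ltW q0.
have d0 : 0 < d%:R :> R by rewrite ltr0n.
have c1 := ncard_conf_gt0R U.
have : (ncard (pairs U U `&` [set x | bad U x.1 o]))%:R * (d%:R ^+ 4 * q ^+ 0) <=
    2 * r ^+ 1 * (c U * c U).
  apply: (@cluster_tail [::]) => // x s [_ bo] us Ks.
  have os : o \in s by apply/Ks; exact: reach_refl.
  split; first by case: (s) os.
  have : all (predU (bad U x.1) (bad U x.2)) s.
    apply/allP => v /Ks/reach_in[->|]; first by apply/orP; left.
    by rewrite /pairbad orbF.
  by rewrite addn0 all_count => /eqP <-; exact: count_predU_le.
have -> : pairs U U `&` [set x | bad U x.1 o] = (conf U `&` [set f | bad U f o]) `*` conf U.
  by apply/seteqP; split=> -[f f'] /=; rewrite /conf_pairs /setX /=; tauto.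
have fc := finite_conf M lo hi exit U.
rewrite ncardX//; last exact: finite_setIl.
rewrite natrM expr1 expr0 mulr1 => h.
rewrite /finite_prob ler_pdivrMr// mulrAC ler_pdivlMr ?exprn_gt0//.
rewrite -(ler_pM2r c1); apply: le_trans (le_trans h _); last by rewrite mulrA.
by rewrite mulrAC.
Qed.

End Tail.

(** * Finite volume identities *)

Section Volume.
Variables (R : realType) (V : eqType) (nb : V -> seq V) (M : nat) (lo hi : V -> int).
Hypothesis sg : simple_graph nb.
Hypothesis lohi : forall v, lo v <= hi v <= lo v + 2 * M%:Z.
Hypothesis hilo : forall u v, v \in nb u -> hi u = lo v + M%:Z.
Hypothesis exit : forall S : seq V, S != [::] ->
  exists s w, [/\ s \in S, w \notin S & w \in nb s].

Local Notation conf := (conf nb M lo hi).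
Local Notation gd := (in_phase lo hi).
Local Notation bad := (out_of_phase nb lo hi).
Local Notation pr := (finite_prob R nb M lo hi).

Lemma finite_confI U E : finite_set (conf U `&` E).
Proof. by apply: finite_setIl; exact: finite_conf. Qed.

Lemma pr_ge0 U E : 0 <= pr U E.
Proof. by rewrite /finite_prob divr_ge0. Qed.

Let conf_pos := ncard_conf_gt0R R sg lohi hilo exit.

Lemma prT U : pr U setT = 1.
Proof. by rewrite /finite_prob setIT divff// gt_eqF// conf_pos. Qed.

Lemma pr_sub U E E' : (forall f, conf U f -> E f -> E' f) -> pr U E <= pr U E'.
Proof.
move=> EE'; rewrite /finite_prob ler_pM2r ?invr_gt0 ?conf_pos// ler_nat.
by apply: ncard_sub; [exact: finite_confI|move=> f [cf /(EE' _ cf)]].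
Qed.

Lemma prID U E B : pr U E = pr U (E `&` B) + pr U (E `\` B).
Proof.
rewrite /finite_prob -mulrDl -natrD (ncardID B (finite_confI U E)).
by rewrite setIA setIDA.
Qed.

Lemma pr_supp U (D : seq V) : exists s : seq (seq int),
  forall f, conf U f -> [seq f v | v <- D] \in s.
Proof.
have fc : finite_set ((fun f : V -> int => [seq f v | v <- D]) @` conf U).
  by apply: finite_image; exact: finite_conf.
exists (fset_set ((fun f : V -> int => [seq f v | v <- D]) @` conf U)) => f cf.
by rewrite in_fset_set// inE; exists f.
Qed.

Definition patch (U : seq V) (h f : V -> int) : V -> int :=
  fun v => if v \in U then h v else f v.

Lemma patch_conf G U h f : conf G f -> {subset with_boundary nb U <= G} ->
  lipschitz_touch nb M U (patch U h f) -> conf G (patch U h f).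
Proof.
move=> [f0 fl fb] UG ht; split.
- move=> v vG; rewrite /patch; case: ifP => vU; last exact: f0.
  by move: vG; rewrite (dom_sub _ (UG _ (dom_sub _ vU))).
- move=> u v uD vD uv; have [uU|uU] := boolP (u \in U); first exact: ht.
  have [vU|vU] := boolP (v \in U).
    by rewrite distrC; apply: ht => //; rewrite /adj -(nb_sym sg).
  by rewrite /patch (negbTE uU) (negbTE vU); exact: fl.
- move=> v vb; rewrite /in_phase /patch; case: ifP => vU; last exact: fb.
  by move/mem_vboundary: vb => -[]; rewrite (UG _ (dom_sub _ vU)).
Qed.

Lemma touch_ext U f g : (forall v, v \in with_boundary nb U -> f v = g v) ->
  lipschitz_touch nb M U f -> lipschitz_touch nb M U g.
Proof.
move=> fg ft u v uU uv; rewrite -!fg; first exact: ft.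
  exact: dom_nb uU uv.
exact: dom_sub.
Qed.

Lemma conf_touch G U f : {subset with_boundary nb U <= G} -> conf G f -> lipschitz_touch nb M U f.
Proof.
move=> UG [_ fl _] u v uU uv; apply: fl => //; apply: dom_sub; apply: UG.
  exact: dom_sub.
exact: dom_nb uU uv.
Qed.

(** A configuration that agrees with g on [W] off [U] amounts to the one with g pasted on [U],
    paired with a Lipschitz extension into [U]. So the count off [U] is the count on [W] times the
    number of extensions. *)
Lemma pr_spec (G U W : seq V) (g : V -> int) :
  {subset with_boundary nb U <= W} -> {subset W <= G} ->
  pr G (cyl W g) = pr G (cyl [seq w <- W | w \notin U] g) * spec nb R M U g.
Proof.
move=> UW WG; have UG : {subset with_boundary nb U <= G} by move=> v /UW/WG.
set W' := [seq w <- W | w \notin U].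
have mW' v : v \in W' = (v \notin U) && (v \in W) by rewrite mem_filter.
rewrite /spec; case: asboolP => [tg|ntg]; last first.
  rewrite mul0r mulr0 /finite_prob (_ : _ `&` _ = set0) ?ncard0 ?mul0r//.
  rewrite -subset0 => f [cf fg]; apply: ntg.
  by apply: touch_ext (conf_touch UG cf) => v /UW/fg.
set C := codes U _.
pose Y := conf G `&` cyl W g; pose X := conf G `&` cyl W' g.
have XY f : X f -> Y (patch U g f).
  move=> [cf fg]; split.
    apply: patch_conf => //; apply: touch_ext tg => v vU; rewrite /patch.
    by case: ifP => // vU'; rewrite fg// mW' vU' UW.
  by move=> v vW; rewrite /patch; case: ifP => // vU; rewrite fg// mW' vU.
have img : (fun f : V -> int => (patch U g f, [seq f v | v <- U])) @` X = Y `*` C.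
  apply/seteqP; split=> [_ [f Xf <-]|[f c] [Yf [h /= ht hc]]].
    split; first exact: XY.
    have [cf fg] := Xf; exists f => //=.
    apply: touch_ext (conf_touch UG cf) => v vU.
    by case: ifP => // vU'; rewrite fg// mW' vU' UW.
  have [cf fg] : Y f := Yf; exists (patch U h f).
    split; last by move=> v; rewrite mW' => /andP[vU vW]; rewrite /patch (negbTE vU) fg.
    apply: patch_conf => //; apply: touch_ext ht => v vU; rewrite /patch.
    by case: ifP => // _; rewrite fg// UW.
  congr pair; last by rewrite -hc; apply/eq_in_map => v vU; rewrite /patch vU.
  apply/funext => v; rewrite /patch /=; have [vU|//] := boolP (v \in U).
  by rewrite fg//; apply: UW; exact: dom_sub.
have inj : {in X &, injective (fun f : V -> int => (patch U g f, [seq f v | v <- U]))}.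
  move=> f f' _ _ [/funeqP pf mf]; apply/funext => v.
  have [vU|vU] := boolP (v \in U); last by have := pf v; rewrite /patch (negbTE vU).
  by move/eq_in_map: mf => /(_ v vU).
have XYC := ncard_bij inj img.
have [[f Xf]|X0] := pselect (exists f, X f); last first.
  rewrite /finite_prob (_ : _ `&` _ = set0); last first.
    rewrite -subset0 => f [cf fg]; apply: X0; exists f; split=> // v.
    by rewrite mW' => /andP[_ /fg].
  rewrite (_ : _ `&` cyl W' g = set0) ?ncard0 ?mul0r//.
  by rewrite -subset0 => f Xf; apply: X0; exists f.
have fX : finite_set X by exact: finite_confI.
have fY : finite_set Y by exact: finite_confI.
(* [Y] is nonempty, so [C] inherits finiteness from the product as its second projection. *)
have fC : finite_set C.
  have : finite_set (Y `*` C) by rewrite -img; exact: finite_image.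
  move/(finite_image snd); apply: sub_finite_set => c Cc.
  by exists (patch U g f, c) => //; split=> //; exact: XY.
have C0 : (0 < ncard C)%N.
  rewrite /ncard cardfs_gt0; apply/fset0Pn; exists [seq g v | v <- U].
  rewrite in_fset_set// inE; exists g => //=; apply: touch_ext tg => v _.
  by case: ifP.
rewrite /finite_prob -/X -/Y XYC ncardX// natrM mul1r.
rewrite -/(ncard C); field.
by rewrite (gt_eqF (conf_pos G)) pnatr_eq0 -lt0n C0.
Qed.

Lemma pr_value_le (U : seq V) o x : o \in U -> ~~ (lo o <= x <= hi o) ->
  pr U [set f | f o = x] <= pr U [set f | bad U f o].
Proof.
move=> oU nx; apply: pr_sub => f cf /= fx; rewrite /out_of_phase /in_phase fx nx andbT.
exact: dom_sub.
Qed.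

(** If all neighbours of o are good, its value may be replaced by x; the old value was within M of
    that of a neighbour, so at most 2M + 1 values are lost. The sum is the union bound for a bad
    neighbour. *)
Lemma pr_value_ge (U : seq V) o x : {subset with_boundary nb [:: o] <= U} -> lo o <= x <= hi o ->
  1 <= (2 * M).+1%:R * pr U [set f | f o = x] +
       \sum_(w <- nb o) pr U [set f | bad U f w].
Proof.
move=> oU gx; have c0 := conf_pos U.
have oU' : o \in U by apply: oU; rewrite dom_sub ?mem_head.
have nbU w : w \in nb o -> w \in U by move=> wo; apply: oU; apply: dom_nb wo; rewrite mem_head.
pose A := conf U `&` [set f | forall w, w \in nb o -> gd f w].
have [_ [w [/[!inE] /eqP-> _ wo]]] := exit (isT : [:: o] != [::]).
have h1 : (ncard A <= (2 * M).+1 * ncard (conf U `&` [set f | f o = x]))%N.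
  rewrite -[X in (X <= _)%N]mul1n -[1%N]/(size [:: x]).
  apply: (@resample _ _ _ o) => //; try exact: finite_confI.
    move=> f; exists (iv (f w - M%:Z) (2 * M).+1); first by rewrite size_iv.
    move=> y [[_ fl _] _].
    have := fl o w (dom_sub _ oU') (dom_sub _ (nbU _ wo)) wo.
    have ow : w != o by apply: contraTneq wo => ->; have [_ ->] := sg o.
    by rewrite /upd eqxx (negbTE ow) mem_iv; lia.
  move=> f z [cf gf]; rewrite inE => /eqP->; split; last by rewrite /= /upd eqxx.
  have -> : upd f o x = patch [:: o] (fun=> x) f.
    by apply/funext => v; rewrite /upd /patch inE.
  apply: patch_conf => // u v; rewrite inE => /eqP-> vo.
  have ov : v != o by apply: contraTneq vo => ->; rewrite /adj; have [_ ->] := sg o.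
  rewrite /patch !inE eqxx (negbTE ov).
  exact: (gd_gd sg hilo vo gx (gf _ vo)).
have h2 : (ncard (conf U) <= ncard A + \sum_(w <- nb o) ncard (conf U `&` [set f | bad U f w]))%N.
  have fc := finite_conf M lo hi exit U.
  rewrite (ncardID [set f | forall w, w \in nb o -> gd f w] fc) leq_add2l.
  apply: leq_trans (@ncard_cover _ _ (nb o) _ (fun w => [set f | bad U f w]) _ _) _.
  - exact: finite_setD.
  - move=> f [cf /existsNP[v /not_implyP[vo /negP ng]]]; exists v => //=.
    by rewrite /out_of_phase ng andbT dom_sub// nbU.
  - by apply: leq_sum => v _; apply: ncard_sub; [exact: finite_confI|move=> f [[]]].
rewrite /finite_prob -mulr_suml mulrA -mulrDl ler_pdivlMr// mul1r.
rewrite -natr_sum -natrM -natrD ler_nat.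
by apply: leq_trans h2 _; rewrite leq_add2r.
Qed.

End Volume.

(** * The measures of the statement as laws on phases *)

Section NuFin.
Variables (R : realType) (V : eqType) (nb : V -> seq V) (M : nat) (col : V -> bool).
Variables (a b : int).
Hypothesis sg : simple_graph nb.

Definition lov (v : V) : int := if col v then a else b - M%:Z.
Definition hiv (v : V) : int := if col v then b else a + M%:Z.

(** Listing the values on the domain is a bijection from the functions vanishing off it to the
    codes, and the boundary conditions agree colour by colour. *)
Lemma nu_finE (U : seq V) (E : set (V -> int)) : depends_on (with_boundary nb U) E ->
  nu_fin nb R M col a b U E = finite_prob R nb M lov hiv U E.
Proof.
move=> dE.
have main E' : depends_on (with_boundary nb U) E' ->
    ncard (codes (with_boundary nb U) (admissible nb M col a b U `&` E')) =
    ncard (conf nb M lov hiv U `&` E').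
  move=> dE'; symmetry.
  apply: (@ncard_bij _ _ (fun f : V -> int => [seq f v | v <- with_boundary nb U])).
    move=> f f'; rewrite !inE => -[[f0 _ _] _] [[f0' _ _] _] /eq_in_map ff'.
    apply/funext => v; have [/ff'//|vD] := boolP (v \in with_boundary nb U).
    by rewrite f0// f0'.
  apply/seteqP; split=> [_ [f [[f0 fl fb] Ef] <-]|c [f [[fl fb] Ef] fc]].
    exists f => //; split=> //; split=> // v /fb; rewrite /in_phase /lov /hiv.
    by case: (col v).
  exists (fun v => if v \in with_boundary nb U then f v else 0); last first.
    by rewrite -fc; apply/eq_in_map => v ->.
  split; last by apply: dE' Ef => v ->.
  split=> [v /negbTE->//|u v uD vD uv|v vb]; first by rewrite uD vD; exact: fl.
  have := fb v vb; rewrite /in_phase /lov /hiv dom_bd//.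
  by case: (col v) => -[h1 h2]; [exact: h1|exact: h2].
rewrite /nu_fin /finite_prob -/(with_boundary nb U); congr (_%:R / _%:R); first exact: main.
have := main setT (fun _ _ _ _ => I); by rewrite !setIT.
Qed.

End NuFin.

(** * Extension of finite dimensional laws *)

Section Local.
Variable V : eqType.

Definition local (E : set (V -> int)) := exists D, depends_on D E.

Lemma depends_sub (D D' : seq V) E : {subset D <= D'} -> depends_on D E -> depends_on D' E.
Proof. by move=> DD' dE f g fg; apply: dE => v /DD'/fg. Qed.

Lemma depends_cyl (D : seq V) g : depends_on D (cyl D g).
Proof. by move=> f f' ff' fg v vD; rewrite -ff'// fg. Qed.

Lemma depends_setI (D : seq V) E E' :
  depends_on D E -> depends_on D E' -> depends_on D (E `&` E').
Proof. by move=> dE dE' f g fg [Ef E'f]; split; [exact: dE Ef|exact: dE' E'f]. Qed.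

Lemma depends_setC (D : seq V) E : depends_on D E -> depends_on D (~` E).
Proof. by move=> dE f g fg nEf Eg; apply: nEf; apply: dE Eg => v vD; rewrite fg. Qed.

Lemma depends_codes (D : seq V) (Q : set (seq int)) :
  depends_on D [set f | Q [seq f v | v <- D]].
Proof. by move=> f g /eq_in_map fg /=; rewrite fg. Qed.

End Local.

Section Extension.
Variables (R : realType) (V : eqType) (e : nat -> V) (p : set (V -> int) -> R).
Hypothesis e_surj : forall v, exists n, e n = v.
Hypothesis p_ge0 : forall E, 0 <= p E.
Hypothesis p_T : p setT = 1.
Hypothesis p_ID : forall E B, local E -> local B -> p E = p (E `&` B) + p (E `\` B).
Hypothesis p_tight : forall (D : seq V) (eps : R), 0 < eps ->
  exists s : seq (seq int), p [set f | [seq f v | v <- D] \notin s] <= eps.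

Local Notation pre n f := [seq f (e i) | i <- iota 0 n].
Let atn n (Q : set (seq int)) : set (V -> int) := [set f | Q (pre n f)].

Lemma local_atn n Q : local (atn n Q).
Proof.
exists [seq e i | i <- iota 0 n] => f g fg; rewrite /atn /=.
rewrite (_ : pre n f = pre n g)//; apply/eq_in_map => i i_n.
by apply: fg; apply/mapP; exists i.
Qed.

Lemma local_setI E E' : local E -> local E' -> local (E `&` E' : set (V -> int)).
Proof.
move=> [D dE] [D' dE']; exists (D ++ D'); apply: depends_setI.
  by apply: depends_sub dE => v vD; rewrite mem_cat vD.
by apply: depends_sub dE' => v vD; rewrite mem_cat vD orbT.
Qed.

Lemma local_setC E : local E -> local (~` E : set (V -> int)).
Proof. by move=> [D dE]; exists D; exact: depends_setC. Qed.

Lemma content_le E E' : local E -> local E' -> E `<=` E' -> p E <= p E'.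
Proof.
move=> lE lE' EE'; rewrite (p_ID lE' lE) (_ : E' `&` E = E) ?lerDl//.
by apply/seteqP; split=> f; [case|move=> Ef; split=> //; exact: EE'].
Qed.

Lemma content0 : p set0 = 0.
Proof.
have lT : local ([set: V -> int]) by exists [::].
by have := p_ID lT lT; rewrite setIT setDT => /esym/eqP; rewrite addrC -subr_eq0 addrK => /eqP.
Qed.

Let w (s : seq int) : R := p (atn (size s) [set s]).

(** A cumulative distribution function of the next value, in the order of [pickle]; its values are
    the cut points inside the interval of s. *)
Let c (s : seq int) (j : nat) : R :=
  p (atn (size s) [set s] `&` [set f | (choice.pickle (f (e (size s))) < j)%N]).

Lemma local_digit n (Q : set int) : local [set f : V -> int | Q (f (e n))].
Proof. by exists [:: e n] => f g fg /=; rewrite fg// mem_head. Qed.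

Lemma cut_local s j :
  local (atn (size s) [set s] `&` [set f | (choice.pickle (f (e (size s))) < j)%N]).
Proof.
apply: local_setI; first exact: local_atn.
exact: (@local_digit (size s) [set z | (choice.pickle z < j)%N]).
Qed.

Lemma cut_homo s j j' : (j <= j')%N -> c s j <= c s j'.
Proof.
move=> jj'; apply: content_le; [exact: cut_local|exact: cut_local|].
by move=> f [? /= fj]; split=> //=; exact: leq_trans fj jj'.
Qed.

Lemma cut0 s : c s 0 = 0.
Proof. by rewrite /c (_ : _ `&` _ = set0) ?content0// -subset0 => f []. Qed.

Lemma cut_le s j : c s j <= w s.
Proof. by apply: content_le; [exact: cut_local|exact: local_atn|move=> f []]. Qed.

Lemma pre_rcons n (f : V -> int) : pre n.+1 f = rcons (pre n f) (f (e n)).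
Proof. by rewrite -addn1 iotaD map_cat cats1. Qed.

Lemma cut_step s z : c s (choice.pickle z).+1 = c s (choice.pickle z) + w (rcons s z).
Proof.
rewrite /c (p_ID (cut_local _ _) (@local_digit (size s) [set z' | (choice.pickle z' < choice.pickle z)%N])).
congr (p _ + p _); apply/seteqP; split=> f /=.
- by move=> [[]].
- by move=> [fs fz]; split=> //; split=> //; exact: ltnW.
- move=> [[fs fz] nfz]; rewrite /atn /= size_rcons pre_rcons fs; congr rcons.
  apply: (pcan_inj (@choice.pickleK int)); apply/eqP.
  by rewrite eqn_leq -ltnS fz leqNgt; apply/negP.
- rewrite /atn /= size_rcons pre_rcons => /rcons_inj[fs fz].
  by rewrite fs fz ltnS leqnn ltnn; split.
Qed.

(** Natural numbers that are not the code of an integer carry no mass. *)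
Lemma cut_step_other s j : (forall z : int, choice.pickle z <> j) -> c s j.+1 = c s j.
Proof.
move=> nj; congr p; apply/seteqP; split=> f [fs /= fj]; split=> //=; last exact: ltnW.
by rewrite ltn_neqAle -ltnS fj andbT; apply/eqP; exact: nj.
Qed.

(** Tightness at the next vertex stands in for countable additivity: finitely many values leave out
    at most half of w s - y. *)
Lemma cut_cvg s y : y < w s -> exists j, y < c s j.
Proof.
move=> ys; have eps0 : 0 < (w s - y) / 2 by lra.
have [L hL] := p_tight [:: e (size s)] eps0.
pose j := (\max_(t <- L) choice.pickle (head 0%Z t)).+1; exists j.
have l1 : local [set f : V -> int | (choice.pickle (f (e (size s))) < j)%N].
  exact: (@local_digit (size s) [set z | (choice.pickle z < j)%N]).
have := p_ID (local_atn (size s) [set s]) l1; rewrite -/(w s) -/(c s j) => h.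
have : p (atn (size s) [set s] `\` [set f | (choice.pickle (f (e (size s))) < j)%N]) <=
    p [set f | [seq f v | v <- [:: e (size s)]] \notin L].
  apply: content_le.
  - by rewrite setDE; apply: local_setI; [exact: local_atn|exact: local_setC].
  - exact: (@local_digit (size s) [set z | [:: z] \notin L]).
  move=> f [_ /= fj]; apply/negP => fL; apply: fj; rewrite ltnS.
  by rewrite (big_rem _ fL) /= leq_maxl.
by lra.
Qed.

Lemma digit_ex s y : 0 <= y < w s ->
  exists z : int, c s (choice.pickle z) <= y < c s (choice.pickle z).+1.
Proof.
move=> /andP[y0 ys]; have [j0 hj0] := cut_cvg ys.
have exj : exists j, y < c s j by exists j0.
case: (ex_minnP exj) => -[|j]; first by rewrite cut0 ltNge y0.
move=> yj jmin; have [[z zj]|nz] := pselect (exists z : int, choice.pickle z = j).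
  exists z; rewrite zj yj andbT leNgt; apply/negP => /jmin.
  by rewrite ltnn.
have : y < c s j by rewrite -cut_step_other// => z zj; apply: nz; exists z.
by move/jmin; rewrite ltnn.
Qed.

Lemma digit_uniq s y (z z' : int) : c s (choice.pickle z) <= y < c s (choice.pickle z).+1 ->
  c s (choice.pickle z') <= y < c s (choice.pickle z').+1 -> z = z'.
Proof.
move=> /andP[h1 h2] /andP[h3 h4]; apply: (pcan_inj (@choice.pickleK int)).
case: (ltngtP (choice.pickle z) (choice.pickle z')) => // lt; exfalso.
  by have := cut_homo s lt; lra.
by have := cut_homo s lt; lra.
Qed.

(* [0, 1) is cut into intervals of lengths [w s], the intervals of the words
   [rcons s z] subdividing that of [s]; a state is the word read so far
   together with the offset of the point inside its interval. *)
Let dig (s : seq int) (y : R) : int :=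
  xget 0 [set z : int | c s (choice.pickle z) <= y < c s (choice.pickle z).+1].

Fixpoint state (x : R) (n : nat) : seq int * R :=
  if n is n'.+1 then
    let: (s, y) := state x n' in
    let z := dig s y in (rcons s z, y - c s (choice.pickle z))
  else ([::], x).

Lemma digP s y : 0 <= y < w s ->
  c s (choice.pickle (dig s y)) <= y < c s (choice.pickle (dig s y)).+1.
Proof. by move=> /digit_ex[z hz]; rewrite /dig; case: xgetP => [z' _ //|/(_ z)]. Qed.

Lemma w_nil : w [::] = 1.
Proof. by rewrite -p_T; congr p; apply/seteqP; split. Qed.

Lemma stateP x n : 0 <= x < 1 ->
  size (state x n).1 = n /\ 0 <= (state x n).2 < w (state x n).1.
Proof.
move=> x01; elim: n => [|n] /=; first by rewrite w_nil.
case: (state x n) => s y /= [sn /digP]; rewrite size_rcons sn cut_step.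
by move=> h; split=> //; lra.
Qed.

Lemma state_interval s : exists2 l, 0 <= l /\ l + w s <= 1 &
  forall x, 0 <= x < 1 ->
    ((state x (size s)).1 = s <-> l <= x < l + w s) /\
    ((state x (size s)).1 = s -> (state x (size s)).2 = x - l).
Proof.
elim/last_ind: s => [|s z [l [l0 l1] IH]].
  by exists 0; rewrite w_nil ?add0r// => x x01; rewrite /= subr0.
(* The interval of [rcons s z] begins at the cut of z inside that of s. *)
exists (l + c s (choice.pickle z)).
  have := cut_homo s (leq0n (choice.pickle z)); rewrite cut0.
  by have := cut_le s (choice.pickle z).+1; rewrite cut_step; lra.
move=> x x01; have [h1 h2] := IH _ x01; have [_] := stateP (size s) x01.
rewrite size_rcons /=; case: (state x (size s)) h1 h2 => t y /= h1 h2 yw.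
split; last first.
  by move=> /rcons_inj[ts zE]; subst t; rewrite zE h2//; lra.
have cz := cut_le s (choice.pickle z).+1; rewrite cut_step in cz.
have c0z : 0 <= c s (choice.pickle z) by rewrite -(cut0 s); exact: cut_homo.
split.
  move=> /rcons_inj[ts zE]; have yE := h2 ts; subst t.
  by have := digP yw; rewrite zE cut_step yE; lra.
move=> hx; have ts : t = s by apply/h1; have := p_ge0 (atn (size (rcons s z)) [set rcons s z]); lra.
have yE := h2 ts; subst t; congr rcons.
apply: (digit_uniq (digP yw)); rewrite cut_step yE; lra.
Qed.

Let G (x : R) (n : nat) : int := nth 0 (state x n.+1).1 n.

Lemma state_mkseq x n : 0 <= x < 1 -> (state x n).1 = [seq G x i | i <- iota 0 n].
Proof.
move=> x01; elim: n => [//|n IH].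
rewrite -addn1 iotaD map_cat -IH /= addn1 /G cats1 add0n /=.
have := stateP n x01; case: (state x n) => s y /= [sn _].
by rewrite nth_rcons sn ltnn eqxx.
Qed.

(** The enumeration may repeat vertices. A word that is read has positive mass, so its event
    contains a function, whose values spell the word and agree at equal vertices. *)
Lemma digit_compat x i j : 0 <= x < 1 -> e i = e j -> G x i = G x j.
Proof.
move=> x01 eij; have [n [ni nj]] : exists n, (i < n)%N /\ (j < n)%N.
  by exists (maxn i j).+1; lia.
have [sn hw] := stateP n x01.
have [f hf] : exists f, atn (size (state x n).1) [set (state x n).1] f.
  apply: contrapT => nf; move: hw; rewrite /w (_ : atn _ _ = set0) ?content0; first by lra.
  by rewrite -subset0 => f hf; apply: nf; exists f.
move: hf; rewrite /atn /= sn state_mkseq// => /eq_in_map hf.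
by rewrite -!hf ?eij// mem_iota.
Qed.

(** By [digit_compat] any index of v serves; points outside [0, 1) get the constant 0. *)
Definition digits (x : R) (v : V) : int :=
  if 0 <= x < 1 then G x (xget 0%N [set i | e i = v]) else 0.

Lemma digits_e x i : 0 <= x < 1 -> digits x (e i) = G x i.
Proof.
move=> x01; rewrite /digits x01; apply: digit_compat => //.
by case: xgetP => [j _ //|/(_ i)] /=.
Qed.

Lemma digits_pre x n : 0 <= x < 1 -> pre n (digits x) = (state x n).1.
Proof. by move=> x01; rewrite state_mkseq//; apply/eq_map => i; rewrite digits_e. Qed.

(** * The image of the uniform law *)

Local Notation mR := (measurableTypeR R).
Let P : probability mR R := uniform_prob (@ltr01 R).

Lemma uniform_itv (l u : R) : 0 <= l -> l <= u -> u <= 1 ->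
  P [set x : mR | l <= x < u] = (u - l)%:E.
Proof.
move=> l0 lu u1; rewrite /P /= /uniform_prob.
have -> : [set x : mR | l <= x < u] = `[l, u[%classic by apply/seteqP; split=> x /=; rewrite in_itv.
rewrite (eq_integral (fun=> 1%:E)); last first.
  move=> x; rewrite inE /= in_itv /= /uniform_pdf => hx.
  by rewrite subr0 invr1 ifT//; lra.
rewrite integral_cst//= mul1e lebesgue_measure_itv /= lte_fin.
case: ltP => // ul; have -> : u = l by lra.
by rewrite subrr.
Qed.

Lemma measurable_co (l u : R) : measurable [set x : mR | l <= x < u].
Proof.
have -> : [set x : mR | l <= x < u] = `[l, u[%classic by apply/seteqP; split=> x /=; rewrite in_itv.
exact: measurable_itv.
Qed.

Let word (s : seq int) : set mR := [set x | 0 <= x < 1 /\ (state x (size s)).1 = s].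

Lemma wordP s : measurable (word s) /\ P (word s) = (w s)%:E.
Proof.
have [l [l0 l1] hl] := state_interval s.
have -> : word s = [set x : mR | l <= x < l + w s].
  apply/seteqP; split=> x /=; first by move=> [x01 /(hl _ x01).1].
  move=> hx; have x01 : 0 <= x < 1 by lra.
  by split=> //; apply/(hl _ x01).1.
split; first exact: measurable_co.
have w0 : 0 <= w s by exact: p_ge0.
rewrite uniform_itv//; last by lra.
by congr (_%:E); lra.
Qed.

Lemma measurable_words n (Q : set (seq int)) :
  measurable [set x : mR | 0 <= x < 1 /\ Q (state x n).1].
Proof.
pose W (s : seq int) := if `[< size s = n /\ Q s >] then word s else set0.
have -> : [set x : mR | 0 <= x < 1 /\ Q (state x n).1] = \bigcup_s W s.
  apply/seteqP; split=> x /=.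
    move=> [x01 Qx]; have [sn _] := stateP n x01.
    by exists (state x n).1 => //; rewrite /W asboolT//; split=> //; rewrite sn.
  move=> [s _]; rewrite /W; case: asboolP => // -[sn Qs] [x01 sx].
  by split=> //; rewrite -sn sx.
apply: countable_bigcupT_measurable => [|s]; first exact: countableP.
by rewrite /W; case: ifP => _; [exact: (wordP s).1|exact: measurable0].
Qed.

Lemma uniform_words n (L : seq (seq int)) : uniq L -> (forall s, s \in L -> size s = n) ->
  P [set x : mR | 0 <= x < 1 /\ (state x n).1 \in L] = (p (atn n [set` L]))%:E.
Proof.
elim: L => [|s L IH] /=.
  move=> _ _; rewrite (_ : [set _ | _] = set0); last by rewrite -subset0 => x [].
  rewrite measure0 (_ : atn _ _ = set0) ?content0//.
  by rewrite -subset0 => f; rewrite /atn /= inE.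
move=> /andP[sL uL] hL; have sn := hL s (mem_head _ _).
have {}IH := IH uL (fun t tL => hL t (@mem_behead _ (s :: L) t tL)).
have -> : [set x : mR | 0 <= x < 1 /\ (state x n).1 \in s :: L] =
    word s `|` [set x : mR | 0 <= x < 1 /\ (state x n).1 \in L].
  apply/seteqP; split=> x /=; rewrite /word /= sn inE.
    by move=> [x01 /orP[/eqP->|h]]; [left|right].
  by move=> [[x01 ->]|[x01 ->]]; rewrite ?eqxx ?orbT.
rewrite measureU; [|exact: (wordP s).1|exact: (measurable_words n [set` L])|]; last first.
  by rewrite -subset0 => x [[_ xs] [_]]; rewrite sn in xs; rewrite xs (negbTE sL).
transitivity ((w s)%:E + (p (atn n [set` L]))%:E)%E.
  by congr (_ + _)%E; [exact: (wordP s).2|exact: IH].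
rewrite -EFinD; congr EFin.
rewrite (p_ID (local_atn n [set` s :: L]) (local_atn n [set s])) /w sn.
congr (p _ + p _); apply/seteqP; split=> f; rewrite /atn /= ?inE.
- by move=> ->; rewrite eqxx.
- by move=> [].
- by move=> fL; rewrite fL orbT; split=> // fs; rewrite fs (negbTE sL) in fL.
- by move=> [/orP[/eqP//|]].
Qed.

(** Tightness replaces [Q] by a finite list of words up to eps. One inequality suffices, since
    [extension] applies it to the complement as well. *)
Lemma uniform_words_ge n (Q : set (seq int)) :
  ((p (atn n Q))%:E <= P [set x : mR | (0 <= x < 1)%R /\ Q (state x n).1])%E.
Proof.
apply/lee_addgt0Pr => eps eps0.
have [L0 hL0] := p_tight [seq e i | i <- iota 0 n] eps0.
pose L := undup [seq s <- L0 | (size s == n) && `[< Q s >]].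
have LE s : s \in L = [&& size s == n, `[< Q s >] & s \in L0].
  by rewrite mem_undup mem_filter andbA.
have := uniform_words (undup_uniq _ : uniq L) (n := n).
have Ln s : s \in L -> size s = n by rewrite LE => /and3P[/eqP].
move=> /(_ Ln) PL.
apply: (@le_trans _ _ ((p (atn n [set` L]))%:E + eps%:E)%E); last first.
  rewrite leeD2r// -PL; apply: le_measure; rewrite ?inE.
  - exact: (measurable_words n [set` L]).
  - exact: measurable_words.
  - by move=> x [x01 /=]; rewrite LE => /and3P[_ /asboolP].
rewrite -EFinD lee_fin (p_ID (local_atn n Q) (local_atn n [set` L])).
apply: lerD.
  apply: content_le; [|exact: local_atn|by move=> f []].
  by apply: local_setI; exact: local_atn.
apply: le_trans hL0; apply: content_le.
- by rewrite setDE; apply: local_setI; [|apply: local_setC]; exact: local_atn.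
- by exists [seq e i | i <- iota 0 n]; exact: (@depends_codes _ _ [set s : seq int | s \notin L0]).
move=> f [Qf nL] /=; rewrite -map_comp; apply/negP => fL; apply: nL.
rewrite /atn /= LE fL andbT size_map size_iota eqxx /=; exact/asboolP.
Qed.

Lemma atn_local E : local E -> exists n, E = atn n [set s | exists2 f, E f & pre n f = s].
Proof.
move=> [D dE]; have [n hn] : exists n, forall v, v \in D -> exists2 i, (i < n)%N & e i = v.
  elim: D {dE} => [|v D [n IH]]; first by exists 0%N.
  have [i iv] := e_surj v; exists (maxn i.+1 n) => u; rewrite inE => /orP[/eqP->|/IH[j jn ju]].
    by exists i => //; rewrite leq_max ltnSn.
  by exists j => //; rewrite leq_max jn orbT.
exists n; apply/seteqP; split=> f; first by exists f.
move=> [g Eg /eq_in_map gf]; apply: dE Eg => v /hn[i i_n <-].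
by apply: gf; rewrite mem_iota.
Qed.

Lemma preimage_local E : local E ->
  exists Q n, [/\ E = atn n Q & digits @^-1` E `&` [set x | 0 <= x < 1] =
    [set x | 0 <= x < 1 /\ Q (state x n).1]].
Proof.
move=> /atn_local[n En]; set Q := [set s | _] in En; exists Q, n; split=> //.
rewrite {1}En; apply/seteqP; split=> x /=; rewrite /atn /=.
  by move=> [+ x01]; rewrite digits_pre.
by move=> [x01]; rewrite digits_pre.
Qed.

Lemma measurable_digits_local (E : set (V -> int)) : local E ->
  measurable (digits @^-1` E : set mR).
Proof.
move=> lE; have [Q [n [_ hE]]] := preimage_local lE.
(* Off [0, 1) the field is constantly 0, so there the preimage is everything or nothing. *)
have -> : digits @^-1` E = (digits @^-1` E `&` [set x | 0 <= x < 1]) `|`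
    (~` [set x | 0 <= x < 1] `&` [set _ | E (fun=> 0)]).
  apply/seteqP; split=> x /=.
    move=> Ex; have [x01|x01] := boolP (0 <= x < 1); [by left|right].
    split; first exact/negP.
    by move: Ex; rewrite /digits (negbTE x01).
  by move=> [[]//|[/negP/negbTE x01]]; rewrite /digits x01.
apply: measurableU; first by rewrite hE; exact: measurable_words.
apply: measurableI; first by apply: measurableC; exact: measurable_co.
by have [h|h] := pselect (E (fun=> 0)); [rewrite (_ : [set _ | _] = setT) //|
  rewrite (_ : [set _ | _] = set0) //]; rewrite ?predeqE.
Qed.

Definition digit_field (x : mR) : Omega V := digits x.

Lemma measurable_digits : measurable_fun setT digit_field.
Proof.
apply: (@measurability _ _ mR (Omega V) setT digit_field (@cylinders V)) => //.
move=> _ [_ [D [g ->]] <-]; rewrite setTI; apply: measurable_digits_local.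
by exists D; exact: depends_cyl.
Qed.

HB.instance Definition _ := isMeasurableFun.Build _ _ mR (Omega V) digit_field measurable_digits.

Theorem extension : exists mu : probability (Omega V) R,
  forall D g, mu (cyl D g) = (p (cyl D g))%:E.
Proof.
exists (distribution P digit_field) => D g.
have lE : local (cyl D g) by exists D; exact: depends_cyl.
have ge E : local E -> ((p E)%:E <= P (digits @^-1` E))%E.
  move=> lE'; have [Q [n [En hE]]] := preimage_local lE'.
  apply: (le_trans (y := P [set x : mR | 0 <= x < 1 /\ Q (state x n).1])).
    by rewrite {1}En; exact: uniform_words_ge.
  rewrite -hE; apply: le_measure; rewrite ?inE.
  - by rewrite hE; exact: measurable_words.
  - exact: measurable_digits_local.
  - by move=> x [].
rewrite -[LHS]/(P (digits @^-1` cyl D g)); apply/eqP; rewrite eq_le ge// andbT.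
have mE := measurable_digits_local lE.
have := ge _ (local_setC lE); rewrite -preimage_setC probability_setC//.
have pC : p (~` cyl D g) = 1 - p (cyl D g).
  have lT : local ([set: V -> int]) by exists [::].
  by rewrite -p_T (p_ID lT lE) setTI setTD; lra.
rewrite pC; have : P (digits @^-1` cyl D g) \is a fin_num by exact: fin_num_measure.
move/fineK <-; move: (fine _) => r; rewrite -[1%E]/(1%:E) -EFinB !lee_fin => h; lra.
Qed.

End Extension.

(** * Graph and numerical estimates *)

Section Graph.
Variables (V : eqType) (nb : V -> seq V).
Hypothesis sg : simple_graph nb.
Hypothesis inf_V : infinite_graph V.
Hypothesis conn : connected_graph nb.

(** A path from [S] to a vertex outside it, which exists since the graph is infinite, has a first
    edge leaving [S]. *)
Lemma exit_edge (S : seq V) : S != [::] ->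
  exists s w, [/\ s \in S, w \notin S & w \in nb s].
Proof.
move=> S0; have [u uS] : exists u, u \in S by case: S S0 => // u S _; exists u; rewrite mem_head.
have [v vS] := inf_V S; have [p [pp lp]] := conn u v.
elim: p u uS pp lp => [|w p IH] u uS /=; first by move=> _ uv; rewrite -uv uS in vS.
move=> /andP[uw pp] lp; have [wS|wS] := boolP (w \in S); first exact: IH wS pp lp.
by exists u, w.
Qed.

Lemma reach_path (B : pred V) x y p : reach nb B x y -> path (adj nb) y p ->
  {subset p <= B} -> forall v, v \in p -> reach nb B x v.
Proof.
elim: p y => [//|w p IH] y ry /= /andP[yw pp] pB v.
have Bw : B w by apply: pB; rewrite mem_head.
have rw : reach nb B x w by apply: reach_step ry _ Bw; exact: nb_nb2.
rewrite inE => /orP[/eqP->//|vp]; apply: (IH w) => // u up.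
by apply: pB; rewrite inE up orbT.
Qed.

(** [pr_close] wants a window reached from o within itself; adding a path from o to each vertex of
    [D] provides one. *)
Lemma connected_hull (o : V) (D : seq V) : exists F : seq V,
  [/\ {subset D <= F}, o \in F & forall v, v \in F -> reach nb (mem F) o v].
Proof.
elim: D => [|x D [F [DF oF FF]]].
  by exists [:: o]; split=> // [|v]; rewrite inE// => /eqP->; exact: reach_refl.
have [p [pp lp]] := conn o x; exists (p ++ F); split.
- move=> v; rewrite inE mem_cat => /orP[/eqP->|/DF vF]; last by rewrite [v \in F]vF orbT.
  by case/lastP: p pp lp => [|p z] _ /=; [move=> <-|
     rewrite last_rcons => ->; rewrite mem_rcons mem_head].
- by rewrite mem_cat oF orbT.
- move=> v; rewrite mem_cat => /orP[vp|/FF].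
    apply: reach_path (reach_refl _ _ _) pp _ _ vp.
    by move=> w wp; rewrite inE mem_cat wp.
  by apply: reach_sub => w wF; rewrite inE mem_cat [w \in F]wF orbT.
Qed.

(** A vertex is coded by the positions, in the neighbour lists, of the steps of a path from o. *)
Lemma countable_graph (o : V) : exists e : nat -> V, forall v, exists n, e n = v.
Proof.
pose dec (s : seq nat) := foldl (fun u i => nth u (nb u) i) o s.
exists (fun n => dec (odflt [::] (choice.unpickle n))) => v.
suff [s <-] : exists s, dec s = v by exists (choice.pickle s); rewrite choice.pickleK.
have [p [pp <-]] := conn o v; rewrite /dec; elim: p o pp {dec} => [|w p IH] u /=.
  by exists [::].
move=> /andP[uw /IH[s hs]]; exists (index w (nb u) :: s).
by rewrite /= nth_index.
Qed.

Lemma cheeger_le (R : realType) (S : seq V) : uniq S ->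
  cheeger nb R * (size S)%:R <= (size (vboundary nb S))%:R.
Proof.
have [->|S0] := eqVneq S [::]; first by rewrite mulr0.
move=> uS; rewrite -ler_pdivlMr ?ltr0n ?lt0n ?size_eq0//.
apply: ge_inf; last by exists S; rewrite undup_id.
by exists 0 => _ [T [_ ->]]; rewrite divr_ge0.
Qed.

End Graph.

(** * Consequences of the lower bound on h *)

Section Numerics.
Variables (R : realType) (d M : nat).
Hypothesis M_gt0 : (1 <= M)%N.
Hypothesis d_gt0 : (0 < d)%N.
Local Notation X := (3 * d%:R ^+ 4 * (4 * M%:R + 1) : R).
Hypothesis d_ge : 4 * M%:R * ln X <= d%:R.

(** This is (4M + 1) X^(-4/3), the price of one bad vertex: 4M + 1 from resampling it, and (1 -
    1/(2M+1))^h <= exp(-h/(2M+1)) from its share of the boundary, where h >= 4M ln X and 4M/(2M+1)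
    >= 4/3. *)
Definition peierls_rate : R := (4 * M%:R + 1) * expR (- (4 / 3 * ln X)).

Let M1 : 1 <= M%:R :> R. Proof. by rewrite ler1n. Qed.

Lemma X_ge : 15 * d%:R ^+ 4 <= X.
Proof.
have : 0 <= d%:R ^+ 4 :> R by rewrite exprn_ge0.
by move: (d%:R ^+ 4) M1 => D m D0; nra.
Qed.

Lemma X_gt0 : 0 < X.
Proof. by apply: lt_le_trans X_ge; rewrite mulr_gt0// exprn_gt0// ltr0n. Qed.

Lemma lnX_expR : expR (ln X) = X.
Proof. by rewrite lnK// posrE X_gt0. Qed.

Lemma d_ge4 : 4 * M%:R <= d%:R :> R.
Proof.
(* From exp(-1/2) >= 1/2; squaring gives e <= 4 < 15 <= X, so ln X >= 1. *)
have half : expR (2^-1) <= 2 :> R.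
  have h := expR_ge1Dx (- 2^-1 : R).
  have : expR (2^-1) * expR (- 2^-1) = 1 :> R by rewrite -expRD subrr expR0.
  by have := expR_gt0 (2^-1 : R); nra.
have one : expR 1 <= 4 :> R.
  have -> : 1 = 2^-1 + 2^-1 :> R by lra.
  by rewrite expRD; have := expR_gt0 (2^-1 : R); nra.
have X15 : 15 <= X.
  apply: le_trans X_ge; have : 1 <= d%:R ^+ 4 :> R by rewrite exprn_ege1// ler1n.
  lra.
have l1 : 1 <= ln X.
  rewrite -ler_expR lnX_expR; lra.
by apply: le_trans d_ge; move: (ln X) l1 M1 => l l1 m; nra.
Qed.

Lemma lnX_ge0 : 0 <= ln X.
Proof.
apply: ln_ge0; apply: le_trans X_ge.
have : 1 <= d%:R ^+ 4 :> R by rewrite exprn_ege1// ler1n.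
lra.
Qed.

Lemma rate_gt0 : 0 < peierls_rate.
Proof. by rewrite mulr_gt0 ?expR_gt0//; have := M1; lra. Qed.

(** The left side is (4/3) X^(-1/3), so the claim is X >= (8/3)^3, which is less than 19. As d >= 4,
    already X >= 15 * 256. *)
Lemma rate_small : 4 * d%:R ^+ 4 * peierls_rate <= 2^-1.
Proof.
have -> : 4 * d%:R ^+ 4 * peierls_rate = 4 / 3 * (X * expR (- (4 / 3 * ln X))).
  by rewrite /peierls_rate; field.
rewrite -{1}lnX_expR -expRD.
have -> : ln X + - (4 / 3 * ln X) = - (ln X / 3) by field.
rewrite expRN; set t := expR (ln X / 3).
have t0 : 0 < t by exact: expR_gt0.
have t3 : t ^+ 3 = X by rewrite -expRM_natl mulrC divfK// lnX_expR.
suff t83 : 8 / 3 <= t by rewrite -ler_pdivlMl// invf_ple ?posrE//; lra.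
rewrite leNgt; apply/negP => tl.
have d4 : 4 <= d%:R :> R by have := d_ge4; have := M1; lra.
have dd : 16 <= d%:R ^+ 2 :> R by rewrite expr2; nra.
have d256 : 256 <= d%:R ^+ 4 :> R by rewrite (exprM _ 2 2) expr2; nra.
have : t ^+ 3 <= (8 / 3) ^+ 3 by rewrite lerXn2r// ?nnegrE; lra.
by rewrite t3; have := X_ge; lra.
Qed.

Lemma rate_le1 : peierls_rate <= 1.
Proof.
have := rate_small; have := rate_gt0.
have : 1 <= d%:R ^+ 4 :> R by rewrite exprn_ege1// ler1n.
by move: (d%:R ^+ 4) peierls_rate => D q; nra.
Qed.

(** This margin keeps the probability of a value inside the phase above that of a value outside
    it. *)
Lemma rate_gap : (2 * M).+1%:R < d%:R ^+ 4 - d%:R :> R.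
Proof.
have -> : (2 * M).+1%:R = 2 * M%:R + 1 :> R by rewrite -natr1 natrM.
have := d_ge4; have := M1.
move: (M%:R) (d%:R) => m D m1 dm.
have dd : 16 <= D ^+ 2 by rewrite expr2; nra.
by rewrite (exprM _ 2 2) [X in X - _]expr2; nra.
Qed.

Lemma peierls_rate_le (h : R) (s b N c : nat) : 4 * M%:R * ln X <= h ->
  h * s%:R <= b%:R ->
  ((2 * M).+1 ^ b * N <= (2 * M) ^ b * ((4 * M).+1 ^ s * c))%N ->
  N%:R <= peierls_rate ^+ s * c%:R.
Proof.
move=> hX hsb; rewrite -(ler_nat R) !natrM !natrX => hN.
have m0 : 0 < (2 * M).+1%:R :> R by rewrite ltr0n.
have m1 := M1.
(* Then 2M = (2M + 1)(1 - y), and 1 - y <= exp(-y). *)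
pose y : R := (2 * M).+1%:R^-1.
have mE : (2 * M)%:R = (2 * M).+1%:R * (1 - y) :> R.
  by rewrite /y mulrBr mulr1 mulfV ?gt_eqF// -[(2 * M).+1%:R]natr1 addrK.
have y0 : 0 <= 1 - y by rewrite -(pmulr_rge0 _ m0) -mE.
have yb : (1 - y) ^+ b <= expR (- (4 / 3 * ln X)) ^+ s.
  apply: (@le_trans _ _ (expR (- y) ^+ b)).
    by rewrite lerXn2r ?nnegrE ?expR_ge0//; have := expR_ge1Dx (- y).
  rewrite -!expRM_natl ler_expR !mulrN lerN2.
  have y43 : 4 / 3 <= 4 * M%:R * y.
    by rewrite /y ler_pdivlMr// -[(2 * M).+1%:R]natr1 natrM; lra.
  have l0 := lnX_ge0.
  have s0 : 0 <= s%:R :> R by [].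
  have yp : 0 <= y by rewrite invr_ge0 ltW.
  apply: (@le_trans _ _ (h * s%:R * y)); last by rewrite ler_wpM2r.
  apply: (@le_trans _ _ (4 * M%:R * ln X * s%:R * y)); last first.
    by rewrite ler_wpM2r// ler_wpM2r.
  have -> : 4 * M%:R * ln X * s%:R * y = (4 * M%:R * y) * (s%:R * ln X) by ring.
  by rewrite mulrCA ler_wpM2r// mulr_ge0.
have ME : (4 * M).+1%:R = 4 * M%:R + 1 :> R by rewrite -natr1 natrM.
rewrite mE exprMn -mulrA ler_pM2l ?exprn_gt0// in hN.
apply: (le_trans hN); rewrite /peierls_rate exprMn ME mulrA.
rewrite ler_wpM2r// mulrC ler_wpM2l// exprn_ge0//; lra.
Qed.

End Numerics.

(** * The infinite volume limit *)

Section Limit.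
Variables (R : realType) (V : eqType) (nb : V -> seq V) (M : nat) (lo hi : V -> int).
Hypothesis sg : simple_graph nb.
Hypothesis conn : connected_graph nb.
Hypothesis lohi : forall v, lo v <= hi v <= lo v + 2 * M%:Z.
Hypothesis hilo : forall u v, v \in nb u -> hi u = lo v + M%:Z.
Hypothesis exit : forall S : seq V, S != [::] ->
  exists s w, [/\ s \in S, w \notin S & w \in nb s].
Variables (d : nat) (q : R).
Hypothesis nbd : forall v, (size (nb v) <= d)%N.
Hypothesis d_gt0 : (0 < d)%N.
Hypothesis q01 : 0 < q <= 1.
Hypothesis clust_le : forall U S : seq V, uniq S -> {subset S <= U} ->
  (ncard (clust nb M lo hi U S))%:R <= q ^+ size S * (ncard (conf nb M lo hi U))%:R.
Hypothesis r_le : 4 * d%:R ^+ 4 * q <= 2^-1.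
Variable o : V.
Local Notation r := (4 * d%:R ^+ 4 * q).
Local Notation pr := (finite_prob R nb M lo hi).
Local Notation bad := (out_of_phase nb lo hi).

Lemma half_pow_le (eps : R) : 0 < eps -> exists2 n, (0 < n)%N & 2^-1 ^+ n <= eps :> R.
Proof.
move=> e0; have ei : 0 <= eps^-1 by rewrite invr_ge0 ltW.
pose n := (Num.Def.archi_bound eps^-1).+1; exists n => //.
rewrite exprVn invf_ple ?posrE ?exprn_gt0//.
apply: (le_trans (ltW (archi_boundP ei))).
by rewrite -natrX ler_nat; apply: leq_trans (ltnW (ltn_expl n (isT : 1 < 2)%N)); exact: leqnSn.
Qed.

Lemma pr_cauchy (D : seq V) (eps : R) : 0 < eps -> exists W : seq V,
  forall E, depends_on D E -> forall U U', {subset W <= U} -> {subset W <= U'} ->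
  `|pr U E - pr U' E| <= eps.
Proof.
move=> e0; have [F [DF oF FF]] := connected_hull sg conn o D.
have /andP[q0 q1] := q01.
have A0 : 0 < d%:R ^+ 4 * q ^+ size F by rewrite mulr_gt0 ?exprn_gt0// ltr0n.
(* The choice of n absorbs the prefactor 2 / (d^4 q^|F|) of [pr_close], which depends on [F] but not
   on the event or the volumes. *)
have [n n0 hn] := half_pow_le (divr_gt0 (mulr_gt0 e0 A0) (ltr0n _ 2)).
exists (walked nb o n) => E dE U U' WU WU'.
have := pr_close sg lohi hilo exit nbd d_gt0 q01 clust_le r_le n0 oF FF WU WU'
  (depends_sub DF dE).
move/le_trans; apply; rewrite ler_pdivrMr//.
have : r ^+ n <= 2^-1 ^+ n by rewrite lerXn2r// nnegrE ?invr_ge0// !mulr_ge0// ?exprn_ge0 ?ltW.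
by move: hn; rewrite ler_pdivlMr//; lra.
Qed.

(* The lower limit of [pr U E] along the directed set of finite volumes. *)
Definition plim (E : set (V -> int)) : R :=
  sup [set x | exists W : seq V, forall U, {subset W <= U} -> x <= pr U E].

Lemma pr_le1 U E : pr U E <= 1.
Proof. by rewrite -(prT R sg lohi hilo exit U); apply: pr_sub => //. Qed.

Lemma plim_ub E : ubound [set x | exists W : seq V, forall U, {subset W <= U} -> x <= pr U E] 1.
Proof. by move=> x [W hW]; apply: le_trans (hW W _) (pr_le1 _ _). Qed.

Lemma plim_ge0 E : 0 <= plim E.
Proof.
apply: ub_le_sup; first by exists 1; exact: plim_ub.
by exists [::] => U _; exact: pr_ge0.
Qed.

(** By the Cauchy property the lower limit is a limit, still uniformly over the events depending on
    [D]. *)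
Lemma plim_near (D : seq V) (eps : R) : 0 < eps -> exists W : seq V,
  forall E, depends_on D E -> forall U, {subset W <= U} -> `|pr U E - plim E| <= eps.
Proof.
move=> e0; have [W hW] := pr_cauchy D e0; exists W => E dE U WU.
have h1 : pr U E - eps <= plim E.
  apply: ub_le_sup; first by exists 1; exact: plim_ub.
  exists W => U' WU'; have := hW E dE U U' WU WU'.
  by rewrite ler_norml => /andP[_]; lra.
have h2 : plim E <= pr U E + eps.
  apply: ge_sup; first by exists 0; exists [::] => U' _; exact: pr_ge0.
  move=> x [W' hW'].
  have h : x <= pr (W ++ W') E by apply: hW' => v vW; rewrite mem_cat vW orbT.
  have WW : {subset W <= W ++ W'} by move=> v vW; rewrite mem_cat vW.
  have := hW E dE U (W ++ W') WU WW; rewrite ler_norml => /andP[]; lra.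
by rewrite ler_norml; apply/andP; split; lra.
Qed.

Lemma eps_eq (x y C : R) : 0 < C -> (forall eps, 0 < eps -> `|x - y| <= C * eps) -> x = y.
Proof.
move=> C0 h; apply/eqP; rewrite -subr_eq0 -normr_le0; apply/ler_addgt0Pr => eps e0.
by rewrite add0r -[eps](divfK (lt0r_neq0 C0)) mulrC; apply: h; rewrite divr_gt0.
Qed.

Lemma plimT : plim setT = 1.
Proof.
apply: (eps_eq ltr01) => eps e0; have [W hW] := plim_near [::] e0.
have := hW setT (fun _ _ _ _ => I) W (fun _ => id).
by rewrite (prT R sg lohi hilo exit) mul1r distrC.
Qed.

Lemma plimID E B : local E -> local B -> plim E = plim (E `&` B) + plim (E `\` B).
Proof.
move=> [D1 dE] [D2 dB]; apply: (@eps_eq _ _ 3) => // eps e0.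
have [W hW] := plim_near (D1 ++ D2) e0.
have {}dE : depends_on (D1 ++ D2) E.
  by apply: depends_sub dE => v vD; rewrite mem_cat vD.
have {}dB : depends_on (D1 ++ D2) B.
  by apply: depends_sub dB => v vD; rewrite mem_cat vD orbT.
have h1 := hW _ dE W (fun _ => id).
have h2 := hW _ (depends_setI dE dB) W (fun _ => id).
have h3 := hW _ (depends_setI dE (depends_setC dB)) W (fun _ => id).
have h := prID R M lo hi exit W E B.
rewrite setDE in h *; move: h1 h2 h3 h; rewrite !ler_norml.
move: (plim E) (plim (E `&` B)) (plim (E `&` ~` B)) => a1 a2 a3.
move: (pr W E) (pr W (E `&` B)) (pr W (E `&` ~` B)) => b1 b2 b3.
by move=> /andP[? ?] /andP[? ?] /andP[? ?] ?; apply/andP; split; lra.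
Qed.

(** In the volume [W] only finitely many words occur on [D]. The list s is chosen after [W], so the
    approximation must be uniform over events, as [plim_near] provides. *)
Lemma plim_tight (D : seq V) (eps : R) : 0 < eps ->
  exists s : seq (seq int), plim [set f | [seq f v | v <- D] \notin s] <= eps.
Proof.
move=> e0; have [W hW] := plim_near D e0.
have [s hs] := pr_supp M lo hi exit W D; exists s.
have := hW _ (@depends_codes _ D [set t : seq int | t \notin s]) W (fun _ => id).
have -> : pr W [set f | [set t | t \notin s] [seq f v | v <- D]] = 0.
  rewrite /finite_prob (_ : _ `&` _ = set0) ?ncard0 ?mul0r//.
  by rewrite -subset0 => f [/hs /= fs]; rewrite fs.
by rewrite sub0r normrN => /(le_trans (ler_norm _)).
Qed.

Lemma plim_spec (U W : seq V) (g : V -> int) : {subset with_boundary nb U <= W} ->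
  plim (cyl W g) = plim (cyl [seq w <- W | w \notin U] g) * spec nb R M U g.
Proof.
move=> UW; set W' := [seq w <- W | w \notin U].
have s0 : 0 <= spec nb R M U g by rewrite /spec divr_ge0.
apply: (@eps_eq _ _ (1 + spec nb R M U g)); first by lra.
move=> eps e0; have [Z hZ] := plim_near W e0.
have dW' : depends_on W (cyl W' g).
  by apply: depends_sub (@depends_cyl _ W' g) => v; rewrite mem_filter => /andP[].
have ZG : {subset Z <= Z ++ W} by move=> v vZ; rewrite mem_cat vZ.
have WG : {subset W <= Z ++ W} by move=> v vZ; rewrite mem_cat vZ orbT.
have h1 := hZ _ (@depends_cyl _ W g) _ ZG.
have h2 := hZ _ dW' _ ZG.
have h := pr_spec R sg lohi hilo exit g UW WG.
move: s0 h1 h2 h; move: (spec nb R M U g) => t.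
rewrite !ler_norml -/W'.
move: (plim (cyl W g)) (plim (cyl W' g)) (pr _ (cyl W g)) (pr _ (cyl W' g)) => a1 a2 b1 b2.
by move=> t0 /andP[? ?] /andP[? ?] ?; apply/andP; split; nra.
Qed.

Lemma pr_bad_le U w : pr U [set f | bad U f w] <= (d%:R ^+ 4)^-1.
Proof.
apply: le_trans (pr_bad sg lohi hilo exit nbd d_gt0 q01 clust_le r_le w U) _.
rewrite -[leRHS]mul1r ler_pM2r ?invr_gt0 ?exprn_gt0 ?ltr0n//.
  move: r_le; move: (r) => z hz; lra.
Qed.

Lemma plim_value_le x : ~~ (lo o <= x <= hi o) ->
  plim (cyl [:: o] (fun=> x)) <= (d%:R ^+ 4)^-1.
Proof.
move=> nx; apply/ler_addgt0Pr => eps e0; have [W hW] := plim_near [:: o] e0.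
have WG : {subset W <= o :: W} by move=> v vW; rewrite inE vW orbT.
have := hW _ (@depends_cyl _ [:: o] (fun=> x)) _ WG.
have := pr_bad_le (o :: W) o.
have := pr_value_le R sg lohi hilo exit (mem_head o W) nx.
have -> : [set f : V -> int | f o = x] = cyl [:: o] (fun=> x).
  by apply/seteqP; split=> f /= fo; [move=> v; rewrite inE => /eqP->|rewrite fo// mem_head].
rewrite ler_norml; move: (_ ^-1) (plim _) (pr _ (cyl _ _)) => D a b.
by move=> /le_trans h /h hD /andP[h1 h2]; lra.
Qed.

Lemma plim_value_ge x : lo o <= x <= hi o ->
  1 <= (2 * M).+1%:R * plim (cyl [:: o] (fun=> x)) + d%:R * (d%:R ^+ 4)^-1.
Proof.
move=> gx; apply/ler_addgt0Pr => eps e0.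
have e1 : 0 < eps / (2 * M).+1%:R by rewrite divr_gt0// ltr0n.
have [W hW] := plim_near [:: o] e1.
have WG : {subset W <= with_boundary nb [:: o] ++ W} by move=> v vW; rewrite mem_cat vW orbT.
have OG : {subset with_boundary nb [:: o] <= with_boundary nb [:: o] ++ W} by move=> v vW; rewrite mem_cat vW.
have := hW _ (@depends_cyl _ [:: o] (fun=> x)) _ WG.
have := pr_value_ge R sg lohi hilo exit OG gx.
have -> : [set f : V -> int | f o = x] = cyl [:: o] (fun=> x).
  by apply/seteqP; split=> f /= fo; [move=> v; rewrite inE => /eqP->|rewrite fo// mem_head].
set G := with_boundary nb [:: o] ++ W.
have : \sum_(w <- nb o) pr G [set f | bad G f w] <= d%:R * (d%:R ^+ 4)^-1.
  apply: (@le_trans _ _ (\sum_(w <- nb o) (d%:R ^+ 4)^-1)).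
    by apply: ler_sum => w _; exact: pr_bad_le.
  rewrite big_const_seq count_predT iter_addr_0 -[leLHS]mulr_natl.
  by rewrite ler_wpM2r ?invr_ge0 ?exprn_ge0// ler_nat.
move: (\sum_(_ <- _) _) (d%:R * _) => S Z.
move: (pr G _) (plim _) => u v.
rewrite ler_norml => SZ h1 /andP[h2 h3].
have m0 : 0 < (2 * M).+1%:R :> R by rewrite ltr0n.
have : (2 * M).+1%:R * (u - v) <= eps by rewrite mulrC -ler_pdivlMr.
by rewrite mulrBr; lra.
Qed.

End Limit.

Theorem theorem1p3 (R : realType) (V : eqType) (nb : V -> seq V)
  (col : V -> bool) (d M : nat) :
  simple_graph nb -> infinite_graph V -> connected_graph nb ->
  proper_2coloring nb col -> max_degree nb d -> (1 <= M)%N ->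
  4 * M%:R * ln (3 * d%:R ^+ 4 * (4 * M%:R + 1)) <= cheeger nb R ->
  exists mu : int -> int -> probability (Omega V) R,
    (forall a b : int, a <= b -> b - a <= 2 * M%:Z ->
       gibbs nb M (mu a b) /\
       forall Gs : nat -> seq V, exhaustion Gs ->
         forall (F : seq V) (g : V -> int),
           (fun n => (nu_fin nb R M col a b (Gs n) (cyl F g))%:E) @ \oo
             --> mu a b (cyl F g)) /\
    (forall a b a' b' : int, a <= b -> b - a <= 2 * M%:Z ->
       a' <= b' -> b' - a' <= 2 * M%:Z -> (a, b) != (a', b') ->
       exists A : set (Omega V), measurable A /\ mu a b A != mu a' b' A).
Proof.
move=> sg infV conn colP [nbd [ o deg_o]] M1 hX.
have exit := exit_edge infV conn.
have d_gt0 : (0 < d)%N.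
  have [s [w [_ _ ws]]] := exit [:: o] isT.
  by apply: leq_trans (nbd s); case: (nb s) ws.
(* The quotient of a single vertex bounds h by d, so the lower bound on h becomes one on d. *)
have hd : cheeger nb R <= d%:R.
  have := @cheeger_le V nb R [:: o] isT; rewrite mulr1 => /le_trans; apply.
  rewrite ler_nat -deg_o; apply: uniq_leq_size; first exact: undup_uniq.
  by move=> v /mem_vboundary[_ [u]]; rewrite inE => /eqP->.
have d_ge := le_trans hX hd.
pose q := peierls_rate R d M.
have q01 : 0 < q <= 1 by rewrite rate_gt0 ?rate_le1.
have r_le := rate_small M1 d_gt0 d_ge.
have clust_le lo hi : (forall v, lo v <= hi v <= lo v + 2 * M%:Z) ->
    (forall u v, v \in nb u -> hi u = lo v + M%:Z) -> forall U S : seq V,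
    uniq S -> {subset S <= U} ->
    (ncard (clust nb M lo hi U S))%:R <= q ^+ size S * (ncard (conf nb M lo hi U))%:R.
  move=> lohi hilo U S uS SU.
  apply: (peierls_rate_le M1 d_gt0 hX (cheeger_le nb R uS)).
  exact: peierls.
have valid a b : a <= b -> b - a <= 2 * M%:Z ->
    (forall v, lov M col a b v <= hiv M col a b v <= lov M col a b v + 2 * M%:Z) /\
    (forall u v, v \in nb u -> hiv M col a b u = lov M col a b v + M%:Z).
  move=> ab ba; rewrite /lov /hiv; split=> [v|u v uv]; first by case: (col v); lia.
  have : col u != col v by exact: colP.
  by case: (col u); case: (col v) => // _; lia.
pose p a b := plim R nb M (lov M col a b) (hiv M col a b).
have [e e_surj] := countable_graph conn o.
have ext a b : a <= b -> b - a <= 2 * M%:Z -> exists m : probability (Omega V) R,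
    forall D g, m (cyl D g) = (p a b (cyl D g))%:E.
  move=> ab ba; have [lohi hilo] := valid a b ab ba; have cl := clust_le _ _ lohi hilo.
  apply: (extension e_surj).
  - by move=> E; exact: plim_ge0.
  - exact: (plimT sg conn lohi hilo exit nbd d_gt0 q01 cl r_le o).
  - exact: (plimID sg conn lohi hilo exit nbd d_gt0 q01 cl r_le o).
  - exact: (plim_tight sg conn lohi hilo exit nbd d_gt0 q01 cl r_le o).
have ext' (ab : int * int) : exists m : probability (Omega V) R,
    ab.1 <= ab.2 -> ab.2 - ab.1 <= 2 * M%:Z ->
    forall D g, m (cyl D g) = (p ab.1 ab.2 (cyl D g))%:E.
  have [h|h] := boolP ((ab.1 <= ab.2) && (ab.2 - ab.1 <= 2 * M%:Z)).
    by case/andP: h => h1 h2; have [m hm] := ext _ _ h1 h2; exists m.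
  (* Pairs outside the range get the measure of (0, 0) as a default. *)
  have [m _] := ext 0 0 (lexx _) isT; exists m => h1 h2.
  by rewrite h1 h2 in h.
have [mu muP] := boolp.choice ext'.
exists (fun a b => mu (a, b)); split.
  move=> a b ab ba; have [lohi hilo] := valid a b ab ba; have cl := clust_le _ _ lohi hilo.
  have mE := muP (a, b) ab ba; rewrite /= in mE; split.
    move=> U W g UW; rewrite !mE -EFinM; congr EFin.
    exact: (plim_spec sg conn lohi hilo exit nbd d_gt0 q01 cl r_le o g UW).
  move=> Gs [Gs_mono Gs_cover] F g; rewrite mE.
  have Gs_sub (W : seq V) : exists N, forall n, (N <= n)%N -> {subset W <= Gs n}.
    have mono n k : {subset Gs n <= Gs (n + k)%N}.
      by elim: k => [|k IH] v vn; rewrite ?addn0// addnS; apply: Gs_mono; exact: IH.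
    elim: W => [|w W [N hN]]; first by exists 0%N.
    have [m wm] := Gs_cover w; exists (maxn m N) => n.
    rewrite geq_max => /andP[mn Nn] v; rewrite inE => /orP[/eqP->|vW].
      by rewrite -(subnKC mn); exact: mono.
    exact: hN vW.
  apply: cvg_EFin; first by apply: nearW.
  apply/cvgrPdist_le => eps e0.
  have [W hW] := plim_near sg conn lohi hilo exit nbd d_gt0 q01 cl r_le o F e0.
  have [N hN] := Gs_sub (W ++ F); exists N => // n /= Nn.
  have dF := @depends_cyl _ F g.
  have FG : {subset F <= with_boundary nb (Gs n)}.
    by move=> v vF; apply: dom_sub; apply: (hN n Nn); rewrite mem_cat vF orbT.
  rewrite nu_finE; last exact: depends_sub FG dF.
  rewrite distrC; apply: hW => // v vW.
  by apply: (hN n Nn); rewrite mem_cat vW.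
have differ a b a' b' x : a <= b -> b - a <= 2 * M%:Z -> a' <= b' -> b' - a' <= 2 * M%:Z ->
    lov M col a b o <= x <= hiv M col a b o ->
    ~~ (lov M col a' b' o <= x <= hiv M col a' b' o) ->
    mu (a, b) (cyl [:: o] (fun=> x)) != mu (a', b') (cyl [:: o] (fun=> x)).
  move=> ab ba ab' ba' gx ngx.
  have [lohi hilo] := valid a b ab ba; have cl := clust_le _ _ lohi hilo.
  have [lohi' hilo'] := valid a' b' ab' ba'; have cl' := clust_le _ _ lohi' hilo'.
  have h1 := plim_value_ge sg conn lohi hilo exit nbd d_gt0 q01 cl r_le gx.
  have h2 := plim_value_le sg conn lohi' hilo' exit nbd d_gt0 q01 cl' r_le ngx.
  rewrite (muP (a, b) ab ba) (muP (a', b') ab' ba'); apply/eqP => -[pp].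
  rewrite -/(p a b _) /= pp /p in h1.
  have gap := rate_gap M1 d_gt0 d_ge.
  have D0 : 0 < d%:R ^+ 4 :> R by rewrite exprn_gt0// ltr0n.
  have := ler_wpM2l (ler0n R (2 * M).+1) h2.
  move: h1 gap D0; move: (d%:R ^+ 4) => D h1 gap D0 h3.
  (* Equal probabilities would give d^4 <= 2M + 1 + d, against [rate_gap]. *)
  have : 1 <= ((2 * M).+1%:R + d%:R) * D^-1 by rewrite mulrDl; lra.
  by rewrite ler_pdivlMr// mul1r; lra.
move=> a b a' b' ab ba ab' ba' neq.
have mA x : measurable (cyl [:: o] (fun=> x) : set (Omega V)).
  by apply: sub_sigma_algebra; exists [:: o], (fun=> x).
(* For either colour of o the phase at o determines the pair, so the two intervals differ; x is the
   smaller of two distinct lower ends, or else the larger of two distinct upper ends. *)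
have [x [[gx ngx]|[gx ngx]]] : exists x,
    (lov M col a b o <= x <= hiv M col a b o /\
      ~~ (lov M col a' b' o <= x <= hiv M col a' b' o)) \/
    (lov M col a' b' o <= x <= hiv M col a' b' o /\
      ~~ (lov M col a b o <= x <= hiv M col a b o)).
  have [lohi _] := valid a b ab ba; have [lohi' _] := valid a' b' ab' ba'.
  have ne : lov M col a b o != lov M col a' b' o \/ hiv M col a b o != hiv M col a' b' o.
    move: neq; rewrite /lov /hiv xpair_eqE negb_and.
    by case: (col o) => /orP[h|h]; lia.
  move: (lohi o) (lohi' o) ne.
  move: (lov M col a b o) (lov M col a' b' o) (hiv M col a b o) (hiv M col a' b' o).
  move=> l l' h h' h1 h2 ne.
  have [ll|ll|ll] := ltgtP l l'; [by exists l; left; lia|by exists l'; right; lia|].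
  have [hh|hh|hh] := ltgtP h h'; [by exists h'; right; lia|by exists h; left; lia|].
  by exfalso; case: ne => /eqP; lia.
- by exists (cyl [:: o] (fun=> x)); split=> //; exact: differ.
- by exists (cyl [:: o] (fun=> x)); split=> //; rewrite eq_sym; exact: differ.
Qed.
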